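(* For any $\epsilon,\delta>0$ and any distribution $\mathcal{D}$ over fair cost-sharing games with $N$ agents and action set $\mathcal{A}$ (with action costs at most $H$), $O\!\left(\frac{|\mathcal{A}|^2H^2}{\epsilon^2}\left(|\mathcal{A}|\log(|\mathcal{A}|N)+\log\frac1\delta\right)\right)$ games drawn i.i.d. from $\mathcal{D}$ suffice to ensure that, with probability at least $1-\delta$ over the draw, the subsidy vector minimizing the average loss $L_{\mathrm{prior}}$ over the sample has expected loss over $\mathcal{D}$ at most $\epsilon$ larger than the expected loss of the best subsidy vector over $\mathcal{D}$.
   Context: Fair cost-sharing game: agents $[N]$, finite action set $\mathcal{A}$, map $f:\mathcal{A}\to2^{[N]}$ (agent $i$ may use action $a$ iff $i\in f(a)$), and (prior expected) action costs $c(a)\le H$. In a joint action $s$, each of the $k$ agents using action $a$ pays $c(a)/k$. A subsidy scheme is a vector $c^{\mathbb{S}}:\mathcal{A}\to[0,H]$; each agent using action $a$ (with $k$ users) receives $c^{\mathbb{S}}(a)/k$, subtracted from its cost. Let $\mathrm{cost}^{\mathbb{S}}(s)$ be the subsidized social cost, $\mathrm{subs}(s)$ the total subsidy paid at $s$, and $\mathcal{S}_{NE}(\mathbb{S})$ the set of pure Nash equilibria of the subsidized game. The loss is $L_{\mathrm{prior}}(\mathbb{S})=\max_{s\in\mathcal{S}_{NE}(\mathbb{S})}\mathrm{cost}^{\mathbb{S}}(s)+\mathrm{subs}(s)$ (at most $2H|\mathcal{A}|$). *)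

(* Defs.v *)
From HB Require Import structures.
From mathcomp Require Import all_boot all_order all_algebra.
From mathcomp Require Import all_classical all_reals all_analysis.
Set Implicit Arguments. Unset Strict Implicit. Unset Printing Implicit Defensive.
Import Order.TTheory GRing.Theory Num.Theory.
Local Open Scope classical_set_scope.
Local Open Scope ring_scope.

Section FairCostSharing.
Variables (R : realType) (N : nat) (A : finType).

Definition joint := {ffun 'I_N -> A}.

(* f : A -> {set 'I_N}; agent i may use a iff i \in f a. *)
Definition feasible (f : A -> {set 'I_N}) (s : joint) : bool :=
  [forall i, i \in f (s i)].

Definition nusers (s : joint) (a : A) : nat := #|[set i | s i == a]|.

Definition deviate (s : joint) (i : 'I_N) (a : A) : joint :=
  [ffun j => if j == i then a else s j].

Definition agent_cost (c cS : A -> R) (s : joint) (i : 'I_N) : R :=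
  (c (s i) - cS (s i)) / (nusers s (s i))%:R.

Definition is_NE (f : A -> {set 'I_N}) (c cS : A -> R) (s : joint) : bool :=
  feasible f s &&
  [forall i, forall a, (i \in f a) ==>
     (agent_cost c cS s i <= agent_cost c cS (deviate s i a) i)].

Definition costS (c cS : A -> R) (s : joint) : R :=
  \sum_(i < N) agent_cost c cS s i.

Definition subs (cS : A -> R) (s : joint) : R :=
  \sum_(i < N) cS (s i) / (nusers s (s i))%:R.

(* L_prior(S) = max over pure NE of cost^S(s) + subs(s)
   (the value 0 is only used if there is no NE; all values are >= 0). *)
Definition loss_prior (f : A -> {set 'I_N}) (c cS : A -> R) : R :=
  \big[Num.max/0]_(s : joint | is_NE f c cS s) (costS c cS s + subs cS s).

Definition subsidy (H : R) (cS : A -> R) : Prop :=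
  forall a, 0 <= cS a <= H.

End FairCostSharing.

Definition mutually_independent (R : realType) (dO : measure_display)
  (Omega : measurableType dO) (P : probability Omega R)
  (dT : measure_display) (T : measurableType dT) (m : nat)
  (X : 'I_m -> Omega -> T) : Prop :=
  forall B : 'I_m -> set T, (forall j, measurable (B j)) ->
    P (\bigcap_(j in [set: 'I_m]) (X j @^-1` B j)) =
    (\prod_(j < m) P (X j @^-1` B j))%E.

(* Main.v *)
Require Import Defs.
From HB Require Import structures.
From mathcomp Require Import all_boot all_order all_algebra.
From mathcomp Require Import all_classical all_reals all_analysis.
From mathcomp Require Import measurable_realfun ring lra zify.
Set Implicit Arguments. Unset Strict Implicit. Unset Printing Implicit Defensive.
Import Order.TTheory GRing.Theory Num.Theory.
Local Open Scope classical_set_scope.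
Local Open Scope ring_scope.

(** The subsidies cancel out of the social cost, so the loss of a game depends on
    the subsidy vector [th] only through the equilibria, that is, through the signs
    of [|A|^2 (N+1)^2] affine forms in [th].  By counting cells of hyperplane
    arrangements, [n] games distinguish at most [(n |A|^2 (N+1)^2 + 1)^|A|] classes
    of subsidy vectors.  To lose no [log m] factor, the uniform deviation between
    empirical and expected losses is bounded by symmetrization with a ghost sample
    and chaining: Dudley's subsampling argument bounds the packing numbers at
    Hamming scale [4^-k] by [(|A| N)^(22 |A| (k+1))], and Hoeffding's inequality for
    random swaps is summed over the links of the chain.  The supremum over the
    uncountable set of subsidies is measurable because each sign pattern is
    realizable exactly on a measurable set of samples, by compactness of the box
    [[0, H]^A] and density of finite grids. *)

(** * Patterns of half-spaces and packing numbers *)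

(** A union bound over all sign patterns of the doubled sample would pay for their number, which
    grows with [m]. Chaining avoids this: refining the scale by a factor 4 raises the log of the net
    size only linearly in the level [k], while the variance of a link drops by a factor 4. With
    allowances shrinking like [(3/4)^k] the tail exponent grows like [(9/4)^k] and wins.

    Two reductions keep the measure theory finite. The loss has the form [val t (pat t th)] with
    finitely many values of [pat], so events over all subsidies become finite unions over patterns
    on a sample. And the good event is defined by the probability, over the ghost sample, of a large
    gap, so that the supremum of the deviations from the expected loss is never itself measured.

    Deviation tests are indexed by two actions and two user counts instead of by joint actions, of
    which there are [|A|^N]; this is why [N] enters the bound only through a logarithm. *)

Section HalfspacePatterns.
Variable R : realFieldType.

Definition halfspace_patterns d n (W : 'M[R]_(d, n)) (b : 'rV[R]_n) :=
  [set p : {ffun 'I_n -> bool} |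
     `[< exists v : 'rV[R]_d, forall l, p l = ((v *m W + b) 0 l <= 0) >]]%SET.

Lemma halfspace_patternsP d n (W : 'M[R]_(d, n)) (b : 'rV[R]_n)
    (p : {ffun 'I_n -> bool}) :
  reflect (exists v : 'rV[R]_d, forall l, p l = ((v *m W + b) 0 l <= 0))
    (p \in halfspace_patterns W b).
Proof. by rewrite finset.inE; exact: asboolP. Qed.

Lemma affine_segment d n (W : 'M[R]_(d, n)) (b : 'rV[R]_n) (v1 v2 : 'rV[R]_d) s l :
  ((v1 + s *: (v2 - v1)) *m W + b) 0 l =
  (1 - s) * (v1 *m W + b) 0 l + s * (v2 *m W + b) 0 l.
Proof.
rewrite mulmxDl -scalemxAl mulmxBl !mxE.
set x := \sum_i _; set y := \sum_i _.
by rewrite /=; lra.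
Qed.

(** Deletion and restriction: without the first form, a pattern of the others extends in at most two
    ways, and one that extends both ways is realized on the zero set of the first form, an affine
    space of dimension [d - 1]. The recursion [(n+1)^d + (n+1)^(d-1) <= (n+2)^d] closes the
    induction. *)
Lemma card_halfspace_patterns d n (W : 'M[R]_(d, n)) (b : 'rV[R]_n) :
  (#|halfspace_patterns W b| <= n.+1 ^ d)%N.
Proof.
elim: n => [|n IHn] in d W b *.
  by rewrite exp1n (leq_trans (max_card _))// card_ffun card_ord expn0.
pose rst (p : {ffun 'I_n.+1 -> bool}) : {ffun 'I_n -> bool} :=
  [ffun l => p (lift ord0 l)].
pose W' : 'M[R]_(d, n) := col' ord0 W; pose b' : 'rV[R]_n := col' ord0 b.
have colE v l : (v *m W' + b') 0 l = (v *m W + b) 0 (lift ord0 l).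
  by rewrite /W' /b' mulmx_colsub !mxE; congr (_ + _); apply: eq_bigr => i _; rewrite !mxE.
pose S := halfspace_patterns W b; pose S' := halfspace_patterns W' b'.
have rstP p : p \in S -> rst p \in S'.
  move=> /halfspace_patternsP[v pv]; apply/halfspace_patternsP; exists v => l.
  by rewrite ffunE pv colE.
pose bth := [set p' in S' | [exists p1 in S, exists p2 in S,
  [&& p1 ord0, ~~ p2 ord0, rst p1 == p' & rst p2 == p']]]%SET.
have ext p1 p2 : rst p1 = rst p2 -> p1 ord0 = p2 ord0 -> p1 = p2.
  move=> /ffunP e e0; apply/ffunP => l; case: (unliftP ord0 l) => [j|] -> //.
  by have := e j; rewrite !ffunE.
have cardS : (#|S| <= #|S'| + #|bth|)%N.
  pose St := [set p in S | ~~ p ord0 && (rst p \in bth)]%SET.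
  rewrite -(cardsID St S); rewrite addnC; apply: leq_add.
    rewrite -(card_in_imset (f := rst)).
      by apply/subset_leq_card/fintype.subsetP => _ /imsetP[p /setDP[pS _] ->]; exact: rstP.
    move=> p1 p2 /setDP[p1S p1n] /setDP[p2S p2n] e; apply: ext => //.
    move: p1n p2n; rewrite ![_ \in St]finset.inE p1S p2S /= => p1n p2n.
    case e1: (p1 ord0); case e2: (p2 ord0) => //.
      exfalso; move: p2n; rewrite e2 /= => /negP; apply; apply/setIdP; split; first exact: rstP.
      by apply/existsP; exists p1; rewrite p1S; apply/existsP; exists p2; rewrite p2S e1 e2 e !eqxx.
    exfalso; move: p1n; rewrite e1 /= => /negP; apply; apply/setIdP; split; first exact: rstP.
    by apply/existsP; exists p2; rewrite p2S; apply/existsP; exists p1; rewrite p1S e1 e2 e !eqxx.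
  rewrite -(card_in_imset (f := rst)).
    apply/subset_leq_card/fintype.subsetP => q /imsetP[p /setIP[_ pSt] ->].
    by move: pSt; rewrite [_ \in St]finset.inE => /and3P[].
  move=> p1 p2 /setIP[_]; rewrite [_ \in St]finset.inE => /and3P[_ p10 _] /setIP[_].
  rewrite [_ \in St]finset.inE => /and3P[_ p20 _] e; apply: ext => //.
  by rewrite (negPf p10) (negPf p20).
apply: (leq_trans cardS); set w := col ord0 W.
have gE v : (v *m W + b) 0 ord0 = (v *m w) 0 0 + b 0 ord0.
  by rewrite /w !mxE; congr (_ + _); apply: eq_bigr => i _; rewrite !mxE.
(* A form with zero linear part has constant sign, so no pattern extends both ways. *)
have [w0|w0] := eqVneq w 0.
  have -> : #|bth| = 0%N.
    apply/eqP; rewrite cards_eq0; apply/eqP/setP => p'; rewrite finset.in_set0.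
    apply/negbTE/negP => /setIdP[_] /existsP[p1 /andP[/halfspace_patternsP[v1 p1v]]].
    move=> /existsP[p2 /andP[/halfspace_patternsP[v2 p2v]]] /and4P[].
    by rewrite p1v p2v !gE w0 !mulmx0 => ->.
  by rewrite addn0 (leq_trans (IHn _ _ _))//; case: (d) => // d'; rewrite leq_exp2r.
have d0 : (0 < d)%N.
  by case: (posnP d) w0 => // d0; move: (w); rewrite d0 => w'; rewrite flatmx0 eqxx.
have rk : \rank (kermx w) = d.-1.
  rewrite mxrank_ker; suff -> : \rank w = 1%N by rewrite subn1.
  apply/eqP; rewrite eqn_leq rank_leq_col lt0n mxrank_eq0 w0 //.
have [v0 v0w] : exists v0 : 'rV[R]_d, (v0 *m w) 0 0 + b 0 ord0 = 0.
  have /rV0Pn[i wi] : w^T != 0 by rewrite trmx_eq0.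
  rewrite mxE in wi.
  exists ((- b 0 ord0 / w i 0) *: delta_mx 0 i).
  rewrite -scalemxAl mxE -rowE [row _ _ _ _]mxE.
  by rewrite mulfVK ?addNr.
pose B := row_base (kermx w).
have bthP : bth \subset halfspace_patterns (B *m W') (v0 *m W' + b').
  apply/fintype.subsetP => p' /setIdP[_ /existsP[p1 /andP[/halfspace_patternsP[v1 p1v]]]].
  move=> /existsP[p2 /andP[/halfspace_patternsP[v2 p2v]]].
  move=> /and4P[p10 p20 /eqP r1 /eqP r2].
  set g1 := (v1 *m W + b) 0 ord0; set g2 := (v2 *m W + b) 0 ord0.
  have g1_le : g1 <= 0 by rewrite /g1 -p1v.
  have g2_gt : 0 < g2 by rewrite ltNge /g2 -p2v.
  have g12 : 0 < g2 - g1 by lra.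
  (* The segment from [v1] to [v2] meets the zero set of the first form at this parameter; both
     sides of every other form are convex, so the common pattern [p'] survives there. *)
  pose s := - g1 / (g2 - g1).
  have s0 : 0 <= s by apply: divr_ge0; lra.
  have s1 : s < 1 by rewrite ltr_pdivrMr //; lra.
  pose v := v1 + s *: (v2 - v1).
  have v_g : (v *m w) 0 0 + b 0 ord0 = 0.
    rewrite -gE affine_segment -/g1 -/g2.
    have : s * (g2 - g1) = - g1 by rewrite /s mulfVK ?gt_eqF.
    by lra.
  have : (v - v0 <= kermx w)%MS.
    apply/sub_kermxP; rewrite mulmxBl; apply/matrixP => i j.
    by rewrite !ord1 !mxE; move: v_g v0w; rewrite !mxE => ? ?; lra.
  rewrite -(eq_row_base (kermx w)) => /submxP[u vE].
  apply/halfspace_patternsP; exists u => l.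
  have -> : u *m (B *m W') + (v0 *m W' + b') = v *m W' + b'.
    by rewrite mulmxA -vE mulmxBl addrA subrK.
  rewrite colE affine_segment.
  move: (p1v (lift ord0 l)) (p2v (lift ord0 l)).
  have -> : p1 (lift ord0 l) = p' l by rewrite -r1 ffunE.
  have -> : p2 (lift ord0 l) = p' l by rewrite -r2 ffunE.
  set x := (v1 *m W + b) _ _; set y := (v2 *m W + b) _ _.
  case: (p' l) => [/esym x0 /esym y0|/esym/negbT x0 /esym/negbT y0]; apply/esym.
    by nra.
  by apply/negbTE; rewrite -!ltNge in x0 y0 *; nra.
have cB : (#|bth| <= n.+1 ^ d.-1)%N.
  by apply: leq_trans (subset_leq_card bthP) _; rewrite -[in leqRHS]rk; exact: IHn.
apply: leq_trans (leq_add (IHn _ _ _) cB) _.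
case: (d) d0 => // d' _ /=; rewrite expnS -{2}[(n.+1 ^ d')%N]mul1n -mulnDl addn1 expnS.
by rewrite leq_mul2l /=; case: (d') => // d''; rewrite leq_exp2r.
Qed.

Lemma card_affine_patterns (A L : finType) (al : L -> A -> R) (be : L -> R)
    (S : {set {ffun L -> bool}}) :
  (forall p, p \in S -> exists th : A -> R,
     forall l, p l = (\sum_a al l a * th a + be l <= 0)) ->
  (#|S| <= #|L|.+1 ^ #|A|)%N.
Proof.
move=> SP.
pose W : 'M[R]_(#|A|, #|L|) := \matrix_(i, l) al (enum_val l) (enum_val i).
pose b : 'rV[R]_#|L| := \row_l be (enum_val l).
pose tr (p : {ffun L -> bool}) : {ffun 'I_#|L| -> bool} := [ffun l => p (enum_val l)].
have tr_inj : injective tr.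
  move=> p1 p2 /ffunP e; apply/ffunP => l.
  by have := e (enum_rank l); rewrite !ffunE enum_rankK.
rewrite -(card_imset _ tr_inj); apply: leq_trans (card_halfspace_patterns W b).
apply/subset_leq_card/fintype.subsetP => q /imsetP[p /SP[th thp] ->].
apply/halfspace_patternsP; exists (\row_i th (enum_val i)) => l.
rewrite ffunE thp !mxE (big_enum_val (fun a => al (enum_val l) a * th a)) /=.
by congr (_ + _ <= _); apply: eq_bigr => i _; rewrite !mxE mulrC.
Qed.

End HalfspacePatterns.

(** Serves to solve [2^p <= (C p)^e] for [p]. With [y] the integer part of [p / e],
    [p <= e (y+1) <= e 2^y], and [2^(y e) <= 2^p]. *)
Lemma expn_le_exp_pow2 p e : (0 < e)%N -> (p ^ e <= e ^ e * 2 ^ p)%N.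
Proof.
move=> e0; pose y := (p %/ e)%N.
have py : (p <= e * 2 ^ y)%N.
  apply: (@leq_trans (e * y.+1)); first by rewrite mulnC ltnW // ltn_ceil.
  by rewrite leq_mul2l ltn_expl // orbT.
apply: (@leq_trans ((e * 2 ^ y) ^ e)); first by rewrite leq_exp2r.
by rewrite expnMn -expnM leq_mul2l leq_pexp2l ?orbT // leq_trunc_div.
Qed.

(** This is [(1 - 1/q)^q <= 1/2]: the first two binomial terms of [((q-1) + 1)^q] are each at least
    [(q-1)^q]. *)
Lemma double_predn_exp_le q : (0 < q)%N -> (2 * q.-1 ^ q <= q ^ q)%N.
Proof.
case: q => // q _ /=; have -> : (q.+1 ^ q.+1 = (q + 1) ^ q.+1)%N by rewrite addn1.
rewrite expnDn.
rewrite big_ord_recl big_ord_recl /= !exp1n !muln1 subn0 bin0 mul1n bin1 subn1 /=.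
rewrite addnA mul2n -addnn; apply: leq_trans (leq_addr _ _).
by rewrite leq_add2l expnS leq_mul.
Qed.

(** * Packing numbers in the Hamming metric *)

Section Packing.
Variables (Q : finType) (m : nat).
Implicit Types p : {ffun 'I_m -> Q}.

Definition hamming p p' := #|[set j | p j != p' j]%SET|.

(** Probabilistic method by counting: a random coordinate fails to distinguish two elements of [T]
    with probability below [1 - 1/q], so [l] coordinates fail with probability at most
    [(1 - 1/q)^l]; summed over at most [#|T|^2] pairs this stays below 1. *)
Lemma exists_separating_sample (T : {set {ffun 'I_m -> Q}}) q l : (0 < m)%N ->
  (forall p p', p \in T -> p' \in T -> p != p' -> (m < q * hamming p p')%N) ->
  (#|T| ^ 2 * q.-1 ^ l < q ^ l)%N ->
  exists io : {ffun 'I_l -> 'I_m},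
    {in T &, injective (fun p => [ffun i => p (io i)] : {ffun 'I_l -> Q})}.
Proof.
move=> m0 sep cT; apply: contrapT => /forallNP noio.
pose bad (io : {ffun 'I_l -> 'I_m}) := [set u in finset.setX T T | (u.1 != u.2) &&
  [forall i, u.1 (io i) == u.2 (io i)]]%SET.
have bad_gt0 io : (0 < #|bad io|)%N.
  apply/card_gt0P; apply: contrapT => /forallNP nb; apply: (noio io).
  move=> p p' pT p'T /ffunP e; apply/eqP/negP => /negP ne; apply: (nb (p, p')).
  rewrite !finset.inE /= pT p'T ne; apply/forallP => i.
  by have := e i; rewrite !ffunE => ->.
have : (q ^ l * m ^ l <= #|T| ^ 2 * (q.-1 ^ l * m ^ l))%N.
  have -> : (m ^ l = \sum_(io : {ffun 'I_l -> 'I_m}) 1)%N.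
    by rewrite sum1_card card_ffun !card_ord.
  rewrite big_distrr /=.
  apply: (@leq_trans (\sum_(io : {ffun 'I_l -> 'I_m}) q ^ l * #|bad io|)).
    by apply: leq_sum => io _; rewrite leq_mul2l bad_gt0 orbT.
  rewrite -big_distrr /=.
  under eq_bigr do rewrite -sum1_card big_mkcond /=.
  rewrite exchange_big /= big_distrr /=.
  have -> : (#|T| ^ 2 = \sum_(u in finset.setX T T) 1)%N.
    by rewrite sum1_card cardsX mulnn.
  rewrite big_distrl [leqRHS]big_mkcond /=; apply: leq_sum => -[p p'] _.
  case: ifPn => [|nT]; last first.
    rewrite big1 ?muln0 // => io _; rewrite finset.inE /= (negPf nT) //.
  rewrite finset.in_setX /= => /andP[pT p'T]; rewrite mul1n.
  have [->|ne] := eqVneq p p'.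
    by rewrite big1 ?muln0 // => io _; rewrite finset.inE /= eqxx andbF.
  have -> : (\sum_(io : {ffun 'I_l -> 'I_m}) (if (p, p') \in bad io then 1 else 0))%N
      = (#|[pred j | p j == p' j]| ^ l)%N.
    rewrite -big_mkcond /= sum1_card -[in RHS](card_ord l) -card_ffun_on.
    apply: eq_card => io; rewrite -[LHS]/((p, p') \in bad io) finset.inE finset.in_setX /= pT p'T ne /=.
    by apply/forallP/ffun_onP => H i; have := H i; rewrite ?inE.
  rewrite sum1_card card_ffun !card_ord -!expnMn.
  case: (posnP l) => [->//|l0]; rewrite leq_exp2r //.
  have := sep _ _ pT p'T ne.
  have : (#|[pred j | p j == p' j]| + hamming p p' = m)%N.
    rewrite -[RHS](card_ord m) -(cardC [pred j | p j == p' j]); congr (_ + _)%N.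
    by apply: eq_card => j; rewrite !inE.
  by case: (q) => [|q'] /=; nia.
rewrite leqNgt => /negP; apply; rewrite mulnA ltn_pmul2r // expn_gt0 m0 //.
Qed.

(* Dudley's argument: a random sample of [O(q log #|T|)] coordinates separates
   all the elements of [T], so [#|T|] is bounded by the growth function at a
   logarithmic sample size. *)
Lemma packing_bound (X T : {set {ffun 'I_m -> Q}}) q M d : (0 < m)%N ->
  (0 < q)%N -> (0 < M)%N -> (0 < d)%N ->
  (forall l (io : {ffun 'I_l -> 'I_m}),
     (#|[set ([ffun i => p (io i)] : {ffun 'I_l -> Q}) | p : {ffun 'I_m -> Q} in X]%SET|
        <= (2 * l * M).+1 ^ d)%N) ->
  T \subset X ->
  (forall p p', p \in T -> p' \in T -> p != p' -> (m < q * hamming p p')%N) ->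
  (#|T| <= 4 * (14 * d * M * q) ^ (2 * d))%N.
Proof.
move=> m0 q0 M0 d0 growth TX sep.
have [T1|T1] := leqP #|T| 1.
  by apply: leq_trans T1 _; rewrite muln_gt0 expn_gt0 !muln_gt0 d0 M0 q0.
pose p := up_log 2 #|T|.
have Tp : (#|T| <= 2 ^ p)%N by exact: up_logP.
have pT : (2 ^ p.-1 < #|T|)%N by exact: up_log_gtn.
have p0 : (0 < p)%N by rewrite up_log_gt0.
(* Each block of [q] coordinates halves the failure probability, so [2p + 1] blocks bring it below
   [2^(-2p)], which is at most [#|T|^-2]. *)
pose l := (q * (2 * p).+1)%N.
have Tl : (#|T| ^ 2 * q.-1 ^ l < q ^ l)%N.
  have ql : (2 ^ (2 * p).+1 * q.-1 ^ l <= q ^ l)%N.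
    rewrite /l !expnM -expnMn leq_exp2r //; exact: double_predn_exp_le.
  case: (posnP (q.-1 ^ l)%N) => [->|ql0]; first by rewrite muln0 expn_gt0 q0.
  apply: leq_trans ql; rewrite ltn_pmul2r //.
  apply: (@leq_ltn_trans ((2 ^ p) ^ 2)); first by rewrite leq_exp2r.
  by rewrite -expnM mulnC ltn_exp2l.
have [io io_inj] := exists_separating_sample m0 sep Tl.
have Tg : (#|T| <= (7 * p * q * M) ^ d)%N.
  rewrite -(card_in_imset io_inj).
  apply: leq_trans (subset_leq_card (imsetS _ TX)) _.
  apply: leq_trans (growth _ io) _; rewrite leq_exp2r // /l.
  have : (0 < p * q * M)%N by rewrite !muln_gt0 p0 q0 M0.
  by nia.
have := ltnW (leq_trans pT Tg); rewrite -(leq_exp2r _ _ (isT : 0 < 2)%N) => sq.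
(* Here [p], the rounded log of [#|T|], occurs on both sides. After squaring,
   [p^(2d) <= (2d)^(2d) 2^p] spends one of the two factors [2^p], and the other bounds [#|T|]. *)
have : (2 ^ p * 2 ^ p <= 4 * (14 * d * M * q) ^ (2 * d) * 2 ^ p)%N.
  apply: (@leq_trans (4 * ((7 * p * q * M) ^ d) ^ 2)%N).
    apply: leq_trans (_ : _ <= 4 * (2 ^ p.-1) ^ 2)%N _; last by rewrite leq_mul2l.
    by rewrite -{1 2}(prednK p0) expnS; nia.
  rewrite -[leqRHS]mulnA leq_mul2l /= -expnM [(d * 2)%N]mulnC.
  have -> : (7 * p * q * M = 7 * q * M * p)%N by nia.
  have -> : (14 * d * M * q = 7 * q * M * (2 * d))%N by nia.
  rewrite [in leqLHS]expnMn [in leqRHS]expnMn -[leqRHS]mulnA leq_mul2l.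
  by rewrite expn_le_exp_pow2 ?orbT // muln_gt0.
by rewrite leq_pmul2r ?expn_gt0 // => /(leq_trans Tp).
Qed.

End Packing.

(** * Signed sums and chaining *)

Section SignedSums.
Variables (R : realType) (m : nat).
Implicit Types (v : 'I_m -> R) (sg : {ffun 'I_m -> bool}).

(** A Rademacher sum; probabilities over the signs are expressed as counts in the cube of [2^m] sign
    vectors. *)
Definition signed_sum sg v : R := \sum_j (-1) ^+ sg j * v j.

Lemma signed_sumD sg v w :
  signed_sum sg (fun j => v j + w j) = signed_sum sg v + signed_sum sg w.
Proof. by rewrite -big_split /=; apply: eq_bigr => j _; rewrite mulrDr. Qed.

Lemma signed_sumN sg v : signed_sum sg (fun j => - v j) = - signed_sum sg v.
Proof. by rewrite -sumrN; apply: eq_bigr => j _; rewrite mulrN. Qed.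

(** The exponent is four times the optimal [x^2 / 2], in exchange for a proof from [1 + y <= expR y]
    alone. For [x^2 <= 1/2] it bounds the sum by [2 / (1 - x^2) <= 2 (1 + 2 x^2)]; otherwise
    [|x| <= 2 x^2]. *)
Lemma cosh_le_expR (x : R) : expR x + expR (- x) <= 2 * expR (2 * x ^+ 2).
Proof.
have ge1 (y : R) : 1 + y <= expR y by exact: expR_ge1Dx.
have [x2|x2] := lerP (x ^+ 2) 2^-1.
  have ab : expR x * expR (- x) = 1 by rewrite -expRD subrr expR0.
  have := ge1 x; have := ge1 (- x); have := ge1 (2 * x ^+ 2).
  have := expR_gt0 x; have := expR_gt0 (- x).
  move: (expR x) (expR (- x)) (expR (2 * x ^+ 2)) ab => a b e ab b0 a0 he hb ha.
  have x1 : -1 < x < 1 by nra.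
  have h1 : a * (1 - x) <= 1 by nra.
  have h2 : b * (1 + x) <= 1 by nra.
  have h3 : (1 - x ^+ 2) * (a + b) <= 2 by nra.
  have h4 : 2 <= (1 - x ^+ 2) * (2 * (1 + 2 * x ^+ 2)) by nra.
  have h5 : 0 < 1 - x ^+ 2 by nra.
  have : a + b <= 2 * (1 + 2 * x ^+ 2) by rewrite -(ler_pM2l h5); lra.
  by lra.
have : expR x <= expR (2 * x ^+ 2) by rewrite ler_expR; nra.
have : expR (- x) <= expR (2 * x ^+ 2) by rewrite ler_expR; nra.
by lra.
Qed.

Lemma sum_expR_signed_sum v (lam : R) :
  \sum_sg expR (lam * signed_sum sg v) <=
  2 ^+ m * expR (2 * lam ^+ 2 * \sum_j v j ^+ 2).
Proof.
have -> : \sum_sg expR (lam * signed_sum sg v) =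
    \prod_j \sum_(b : bool) expR (lam * ((-1) ^+ b * v j)).
  rewrite bigA_distr_bigA /=; apply: eq_bigr => sg _.
  by rewrite /signed_sum big_distrr expR_sum.
rewrite mulr_sumr expR_sum.
have -> : 2 ^+ m = \prod_(j < m) (2 : R) by rewrite prodr_const card_ord.
rewrite -big_split /=; apply: ler_prod => j _; rewrite big_bool /=.
rewrite expr1 expr0 mul1r mulN1r mulrN addr_ge0 ?expR_ge0 //= addrC.
by rewrite (le_trans (cosh_le_expR _)) // exprMn mulrA.
Qed.

(** Chernoff bound: [lam = t / (4 V)] minimizes [2 lam^2 V - lam t], with value [- t^2 / (8 V)]. *)
Lemma card_signed_sum_gt v (V t : R) : 0 < V -> 0 <= t ->
  \sum_j v j ^+ 2 <= V ->
  #|[set sg | t < signed_sum sg v]%SET|%:R <= 2 ^+ m * expR (- (t ^+ 2 / (8 * V))).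
Proof.
move=> V0 t0 vV; pose lam := t / (4 * V).
have lam0 : 0 <= lam by apply: divr_ge0 => //; lra.
rewrite -(@ler_pM2r _ (expR (lam * t))) ?expR_gt0 //.
apply: (@le_trans _ _ (\sum_sg expR (lam * signed_sum sg v))).
  rewrite -sum1_card natr_sum mulr_suml big_mkcond /=; apply: ler_sum => sg _.
  case: ifPn => [|_]; last exact: expR_ge0.
  by rewrite finset.inE mul1r ler_expR => /ltW; exact: ler_wpM2l.
apply: le_trans (sum_expR_signed_sum _ _) _; rewrite -[leRHS]mulrA -expRD ler_pM2l ?exprn_gt0 //.
rewrite ler_expR; apply: (@le_trans _ _ (2 * lam ^+ 2 * V)).
  by apply: ler_wpM2l => //; rewrite mulr_ge0 // sqr_ge0.
have V1 : V != 0 by rewrite gt_eqF.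
suff -> : 2 * lam ^+ 2 * V = - (t ^+ 2 / (8 * V)) + lam * t by [].
by rewrite /lam; field.
Qed.

Lemma card_norm_signed_sum_gt v (V t : R) : 0 < V -> 0 <= t ->
  \sum_j v j ^+ 2 <= V ->
  #|[set sg | t < `|signed_sum sg v|]%SET|%:R <=
    2 * 2 ^+ m * expR (- (t ^+ 2 / (8 * V))).
Proof.
move=> V0 t0 vV; rewrite -mulrA mulrDl !mul1r.
have nV : \sum_j (- v j) ^+ 2 <= V by under eq_bigr do rewrite sqrrN.
apply: le_trans (lerD (card_signed_sum_gt V0 t0 vV) (card_signed_sum_gt V0 t0 nV)).
rewrite -natrD ler_nat; apply: leq_trans (leq_card_setU _ _).
apply/subset_leq_card/fintype.subsetP => sg; rewrite !finset.inE signed_sumN.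
by rewrite lter_normr.
Qed.

End SignedSums.

Lemma card_bigcup_le (I T : finType) (P : pred I) (F : I -> {set T}) :
  (#|(\bigcup_(i | P i) F i)%SET| <= \sum_(i | P i) #|F i|)%N.
Proof.
elim/big_rec2: _ => [|i n S _ Sn]; first by rewrite cards0.
by apply: leq_trans (leq_card_setU _ _) _; rewrite leq_add2l.
Qed.

Lemma ler_card_bigcup (R : numDomainType) (I T : finType) (P : pred I)
    (F : I -> {set T}) (G : I -> R) :
  (forall i, P i -> #|F i|%:R <= G i) ->
  #|(\bigcup_(i | P i) F i)%SET|%:R <= \sum_(i | P i) G i.
Proof.
move=> FG; apply: le_trans (ler_sum _ FG).
by rewrite -natr_sum ler_nat; exact: card_bigcup_le.
Qed.

Lemma geometric_sum_le (R : realType) (u : R) n : 0 <= u -> u <= 2^-1 ->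
  \sum_(k < n) u ^+ k.+1 <= 2 * u.
Proof.
move=> u0 u1; suff : (1 - u) * \sum_(k < n) u ^+ k.+1 = u - u ^+ n.+1.
  have := exprn_ge0 n.+1 u0.
  have : 0 <= \sum_(k < n) u ^+ k.+1 by apply: sumr_ge0 => k _; exact: exprn_ge0.
  by nra.
elim: n => [|n IHn]; first by rewrite big_ord0 mulr0 expr1 subrr.
by rewrite big_ord_recr /= mulrDr IHn [u ^+ n.+2]exprS; ring.
Qed.

(** * Chaining along Hamming nets *)

Section Chaining.
Variables (R : realType) (Q : finType) (m : nat) (X : {set {ffun 'I_m -> Q}}).
Variables (a : 'I_m -> Q -> R) (B : R).
Hypotheses (B0 : 0 < B) (aB : forall j q, `|a j q| <= B) (m0 : (0 < m)%N).
Implicit Types p : {ffun 'I_m -> Q}.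

Lemma hamming_triangle p1 p2 p3 :
  (hamming p1 p3 <= hamming p1 p2 + hamming p2 p3)%N.
Proof.
apply: leq_trans (leq_card_setU _ _); apply/subset_leq_card/fintype.subsetP => j.
rewrite !finset.inE => p13; have [e|//] := eqVneq (p1 j) (p2 j).
by move: p13; rewrite e.
Qed.

Lemma hammingC p1 p2 : hamming p1 p2 = hamming p2 p1.
Proof. by apply: eq_card => j; rewrite !finset.inE eq_sym. Qed.

Lemma hamming_eq0 p1 p2 : hamming p1 p2 = 0%N -> p1 = p2.
Proof.
move=> /eqP; rewrite cards_eq0 => /eqP/setP h; apply/ffunP => j.
by have := h j; rewrite !finset.inE => /negbT; rewrite negbK => /eqP.
Qed.

(** Turns Hamming scale into variance: only coordinates where the patterns differ contribute, each
    at most [(2 B)^2]. *)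
Lemma sum_sqr_diff_le p1 p2 :
  \sum_j (a j (p2 j) - a j (p1 j)) ^+ 2 <= 4 * B ^+ 2 * (hamming p1 p2)%:R.
Proof.
rewrite /hamming -sum1_card natr_sum mulr_sumr [leRHS]big_mkcond /=.
apply: ler_sum => j _; rewrite finset.inE; case: eqVneq => [->|_] /=.
  by rewrite subrr expr0n.
have := aB j (p1 j); have := aB j (p2 j); rewrite !ler_norml => /andP[? ?] /andP[? ?].
by nra.
Qed.

Definition separated q (T : {set {ffun 'I_m -> Q}}) := [forall p in T, forall p' in T,
  (p != p') ==> (m < q * hamming p p')%N].

(** A maximal separated subset of [X] is a net, since a point farther than [m / q] from all its
    elements could be added. *)
Lemma exists_net q : exists T : {set {ffun 'I_m -> Q}}, [/\ T \subset X, separated q T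
  & forall p, p \in X -> exists2 p', p' \in T & (q * hamming p p' <= m)%N].
Proof.
pose P (T : {set {ffun 'I_m -> Q}}) := (T \subset X) && separated q T.
have [T /maxsetP[/andP[TX sT] Tmax]] : {T | maxset P T}.
  apply: ex_maxset; exists finset.set0; rewrite /P finset.sub0set /=.
  by apply/forall_inP => p; rewrite finset.inE.
exists T; split=> // p pX; apply: contrapT => np.
have far p' : p' \in T -> (m < q * hamming p p')%N.
  by move=> p'T; rewrite ltnNge; apply/negP => le; apply: np; exists p'.
have PT : P (p |: T)%SET.
  rewrite /P finset.subUset finset.sub1set pX TX /=.
  apply/forall_inP => p1 /setU1P[->|p1T]; apply/forall_inP => p2 /setU1P[->|p2T].
  - by rewrite eqxx.
  - by apply/implyP => _; exact: far.
  - by apply/implyP => _; rewrite hammingC; exact: far.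
  - by move/forall_inP : sT => /(_ _ p1T) /forall_inP /(_ _ p2T).
have pT : p \in T by rewrite -(Tmax _ PT (finset.subsetU1 _ _)) finset.setU11.
apply: np; exists p => //.
suff -> : hamming p p = 0%N by rewrite muln0.
by apply/eqP; rewrite cards_eq0; apply/eqP/setP => j; rewrite !finset.inE eqxx.
Qed.

(* Chaining along nets at the Hamming scales [m / 4 ^ k]; the deviation allowed
   at level [k] is a fraction [(3 / 4) ^ k / 6] of [eta], so that the levels sum
   to [eta / 2] while the exponents grow like [(9 / 4) ^ k]. *)
Lemma card_sup_signed_sum_gt (eta delta : R) (Y : nat) :
  0 < eta -> delta <= 1 -> (0 < Y)%N ->
  (forall k (T : {set {ffun 'I_m -> Q}}), T \subset X -> separated (4 ^ k) T ->
     (#|T| <= Y ^ k.+1)%N) ->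
  Y%:R ^+ 2 * expR (- (m%:R * eta ^+ 2 / (72 * 80 * B ^+ 2))) <= delta / 8 ->
  #|[set sg | [exists p in X, m%:R * eta < `|signed_sum sg (fun j => a j (p j))|]]%SET|%:R
    <= delta / 2 * 2 ^+ m.
Proof.
move=> eta0 delta1 Y0 XY udelta.
have [Nt NtP] := choice (fun k : nat => exists_net (4 ^ k)%N).
pose S sg p := signed_sum sg (fun j => a j (p j)).
pose E0 := (\bigcup_(p in Nt 0%N) [set sg | m%:R * eta / 2 < `|S sg p|%R]%R)%SET.
(* Only links that a chain can use are counted: a pattern is within [m / 4^k] of its point at level
   [k] and within [m / 4^(k+1)] of the next one, hence the [5]. *)
pose E k := (\bigcup_(w in finset.setX (Nt k) (Nt k.+1) |
    (4 ^ k.+1 * hamming w.1 w.2 <= 5 * m)%N)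
  [set sg | m%:R * eta / 8 * (3 / 4) ^+ k < `|S sg w.2 - S sg w.1|]%R)%SET.
set bad := finset _.
have meta0 : 0 < m%:R * eta by rewrite mulr_gt0 // ltr0n.
have bad_sub : bad \subset (E0 :|: \bigcup_(k < m) E k)%SET.
  apply/fintype.subsetP => sg; rewrite finset.inE => /exists_inP[p pX badp].
  apply: contraLR badp; rewrite finset.in_setU negb_or -leNgt => /andP[nE0 nE].
  (* The allowance is [m eta / 2] at the root plus [(m eta / 8) (3/4)^j] for each [j < k], which
     sums to [(m eta / 2) (2 - (3/4)^k)]. *)
  have step k : (k <= m)%N -> exists2 pk, pk \in Nt k &
      (4 ^ k * hamming p pk <= m)%N /\
      `|S sg pk| <= m%:R * eta / 2 * (2 - (3 / 4) ^+ k).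
    elim: k => [_|k IHk km].
      have [_ _ /(_ p pX)[p0 p0N hp0]] := NtP 0%N; exists p0 => //; split=> //.
      rewrite expr0 (addrK 1 1 : 2 - 1 = 1 :> R) mulr1.
      rewrite leNgt; apply: contra nE0 => h; apply/bigcupP; exists p0 => //.
      by rewrite finset.inE.
    have [pk pkN [hpk Spk]] := IHk (ltnW km).
    have [_ _ /(_ p pX)[p' p'N hp']] := NtP k.+1; exists p' => //; split=> //.
    have hh : (4 ^ k.+1 * hamming pk p' <= 5 * m)%N.
      apply: leq_trans (leq_mul (leqnn _) (hamming_triangle pk p p')) _.
      rewrite mulnDr (hammingC pk p) {1}expnS -mulnA.
      by move: (4 ^ k * _)%N (4 ^ k.+1 * _)%N hpk hp' => A1 A2 {nE0 nE}; clear; lia.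
    have : `|S sg p' - S sg pk| <= m%:R * eta / 8 * (3 / 4) ^+ k.
      rewrite leNgt; apply: contra nE => h; apply/bigcupP; exists (Ordinal km) => //=.
      apply/bigcupP; exists (pk, p'); first by rewrite finset.in_setX pkN p'N hh.
      by rewrite finset.inE.
    have := ler_normD (S sg pk) (S sg p' - S sg pk); rewrite addrC subrK.
    by rewrite exprS; move: ((3 / 4) ^+ k) Spk => z; lra.
  have [pm _ [hpm Spm]] := step m (leqnn m).
  (* At level [m] the scale is below one coordinate, as [m < 4^m], so the chain ends at [p]
     itself. *)
  have -> : p = pm.
    apply: hamming_eq0; apply/eqP; rewrite -leqn0 -ltnS.
    rewrite -(@ltn_pmul2l (4 ^ m)) ?expn_gt0 // muln1.
    by apply: leq_ltn_trans hpm _; exact: ltn_expl.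
  apply: le_trans Spm _.
  have : 0 <= (3 / 4 : R) ^+ m by apply: exprn_ge0; lra.
  by move: ((3 / 4) ^+ m) => z; nra.
(* The constant [72 * 80 = 8 * 20 * 8^2 * (9/4) / 4] makes the tail exponent at level [k] equal to
   [x (9/4)^(k+1)]. *)
pose x := m%:R * eta ^+ 2 / (72 * 80 * B ^+ 2).
have B1 : B != 0 by rewrite gt_eqF.
have mR0 : 0 < m%:R :> R by rewrite ltr0n.
have mR1 : m%:R != 0 :> R by rewrite gt_eqF.
have x0 : 0 <= x.
  have B20 : 0 < B ^+ 2 by exact: exprn_gt0.
  apply: divr_ge0; first by rewrite mulr_ge0 ?sqr_ge0 // ltW.
  by apply: mulr_ge0 (ltW B20); rewrite mulr_ge0.
(* A level has at most [Y^(k+1) Y^(k+2) <= (Y^2)^(k+2)] links, and [k + 2 <= (9/4)^(k+1)]; so level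
   [k] costs at most [u^(k+2)], up to the common factor. *)
pose u := Y%:R ^+ 2 * expR (- x).
have YR1 : 1 <= Y%:R :> R by rewrite ler1n.
have cE0 : #|E0|%:R <= 2 * 2 ^+ m * u.
  apply: (@le_trans _ _ (\sum_(p in Nt 0%N) 2 * 2 ^+ m * expR (- x))).
    apply: ler_card_bigcup => p _.
    apply: le_trans (card_norm_signed_sum_gt (V := B ^+ 2 * m%:R) _ _ _) _.
    - by rewrite mulr_gt0 // exprn_gt0.
    - by lra.
    - rewrite -[X in _ * X%:R](card_ord m) mulr_natr -sumr_const.
      apply: ler_sum => j _; have := aB j (p j); rewrite ler_norml => /andP[? ?].
      by nra.
    rewrite ler_pM2l ?mulr_gt0 ?exprn_gt0 // ler_expR lerN2.
    have -> : (m%:R * eta / 2) ^+ 2 / (8 * (B ^+ 2 * m%:R)) = 180 * x.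
      by rewrite /x; field; rewrite B1 mR1.
    by lra.
  rewrite sumr_const -[leLHS]mulr_natr -[leLHS]mulrA ler_pM2l ?mulr_gt0 ?exprn_gt0 //.
  rewrite mulrC /u ler_pM2r ?expR_gt0 //; have [NX Nsep _] := NtP 0%N.
  have := XY 0%N _ NX Nsep; rewrite expn1 -(ler_nat R).
  by nra.
have cE k : #|E k|%:R <= 2 * 2 ^+ m * u ^+ k.+2.
  apply: (@le_trans _ _ (\sum_(w in finset.setX (Nt k) (Nt k.+1) |
     (4 ^ k.+1 * hamming w.1 w.2 <= 5 * m)%N) 2 * 2 ^+ m * expR (- x * k.+2%:R))).
    apply: ler_card_bigcup => -[p p'] /= /andP[_ hpp'].
    have -> : [set sg | m%:R * eta / 8 * (3 / 4) ^+ k < `|S sg p' - S sg p|]%SET =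
      [set sg | m%:R * eta / 8 * (3 / 4) ^+ k <
         `|signed_sum sg (fun j => a j (p' j) - a j (p j))|]%SET.
      by apply/setP => sg; rewrite !finset.inE signed_sumD signed_sumN.
    have q0 : 0 < (4 : R) ^+ k.+1 by rewrite exprn_gt0.
    have q1 : (4 : R) ^+ k.+1 != 0 by rewrite gt_eqF.
    apply: le_trans (card_norm_signed_sum_gt (V := 20 * B ^+ 2 * m%:R / 4 ^+ k.+1) _ _ _) _.
    - by rewrite divr_gt0 // !mulr_gt0 // exprn_gt0.
    - by rewrite mulr_ge0 ?exprn_ge0 //; lra.
    - apply: le_trans (sum_sqr_diff_le _ _) _; rewrite ler_pdivlMr //.
      move: hpp'; rewrite -(ler_nat R) !natrM natrX => hpp'.
      have -> : 4 * B ^+ 2 * (hamming p p')%:R * 4 ^+ k.+1 =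
        4 * B ^+ 2 * (4 ^+ k.+1 * (hamming p p')%:R) by ring.
      have -> : 20 * B ^+ 2 * m%:R = 4 * B ^+ 2 * (5 * m%:R) by ring.
      by rewrite ler_pM2l // mulr_gt0 // exprn_gt0.
    rewrite ler_pM2l ?mulr_gt0 ?exprn_gt0 // ler_expR mulNr lerN2.
    have -> : (m%:R * eta / 8 * (3 / 4) ^+ k) ^+ 2 / (8 * (20 * B ^+ 2 * m%:R / 4 ^+ k.+1))
      = x * (9 / 4) ^+ k.+1.
      rewrite /x; have -> : (9 / 4 : R) ^+ k.+1 = (9 / 16) * ((3 / 4) ^+ k) ^+ 2 * 4 ^+ k.+1.
        rewrite exprAC exprS [4 ^+ _]exprS -[X in _ = X * _](_ : 9 / 16 * (9 / 16) ^+ k = _).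
          have -> : (9 / 4 : R) ^+ k = (9 / 16) ^+ k * 4 ^+ k.
            by rewrite -exprMn; congr (_ ^+ _); lra.
          by field.
        by congr (_ * _ ^+ _); field.
      by field; rewrite B1 mR1 q1.
    apply: ler_wpM2l => //; elim: (k.+1) => [|n IHn]; first by rewrite expr0.
    have n1 : 1 <= n.+1%:R :> R by rewrite ler1n.
    rewrite exprS -natr1; apply: le_trans (_ : _ <= 9 / 4 * n.+1%:R) _; first by lra.
    by rewrite ler_pM2l; lra.
  rewrite -mulr_sumr ler_pM2l ?mulr_gt0 ?exprn_gt0 //.
  apply: (@le_trans _ _ (\sum_(w in finset.setX (Nt k) (Nt k.+1)) expR (- x * k.+2%:R))).
    by rewrite big_mkcondr /=; apply: ler_sum => w _; case: ifP => // _; exact: expR_ge0.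
  rewrite sumr_const -[leLHS]mulr_natl /u exprMn -expRM_natr ler_pM2r ?expR_gt0 //.
  have [NX Nsep _] := NtP k; have [NX' Nsep' _] := NtP k.+1.
  rewrite cardsX -exprM -natrX ler_nat.
  apply: leq_trans (leq_mul (XY _ _ NX Nsep) (XY _ _ NX' Nsep')) _.
  by rewrite -expnD leq_pexp2l // mul2n -addnn leq_add2r.
(* The root contributes the term [u]. As [delta <= 1], [u <= delta / 8] is below [1/2], and the
   geometric series is at most [2 u]. *)
apply: (@le_trans _ _ (2 * 2 ^+ m * \sum_(k < m.+1) u ^+ k.+1)).
  rewrite big_ord_recl expr1 mulrDr mulr_sumr.
  apply: (@le_trans _ _ (#|E0| + \sum_(k < m) #|E k|)%N%:R).
    rewrite ler_nat; apply: leq_trans (subset_leq_card bad_sub) _.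
    by apply: leq_trans (leq_card_setU _ _) _; rewrite leq_add2l; exact: card_bigcup_le.
  by rewrite natrD natr_sum; apply: lerD => //; apply: ler_sum => k _; exact: cE.
have u0 : 0 <= u by rewrite mulr_ge0 ?exprn_ge0 // expR_ge0.
have := geometric_sum_le m.+1 u0; rewrite -/x -/u in udelta.
have : 0 < (2 : R) ^+ m by rewrite exprn_gt0.
move: (\sum_(k < m.+1) _) (2 ^+ m) => z M2 M20 /(_ ltac:(lra)) zu.
by nra.
Qed.

End Chaining.

(** * Independent samples *)

Lemma measurable_set_bool d (S : measurableType d) (b : S -> bool) :
  measurable_fun setT b -> measurable [set s | b s].
Proof.
move=> mb; rewrite [X in measurable X](_ : _ = setT `&` b @^-1` [set true]).
  exact: mb.
by rewrite setTI preimage_true.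
Qed.

Lemma measurable_forall d (S : measurableType d) (I : finType) (B : I -> S -> bool) :
  (forall i, measurable_fun setT (B i)) -> measurable_fun setT (fun s => [forall i, B i s]).
Proof.
move=> mB; apply: (measurable_fun_bool true); rewrite setTI preimage_true.
rewrite [X in measurable X](_ : _ = \bigcap_(i in [set: I]) [set s | B i s]).
  by apply: fin_bigcap_measurable => // i _; exact: measurable_set_bool.
apply/seteqP; split=> s /=; first by move=> /forallP h i _; exact: h.
by move=> h; apply/forallP => i; exact: h.
Qed.

Section ProductLaw.
Variables (R : realType) (dT : measure_display) (T : measurableType dT).
Variable D : probability T R.

Definition sample_tuple n (S : Type) (Y : 'I_n -> S -> T) (s : S) : n.-tuple T :=
  [tuple Y i s | i < n].

Lemma measurable_sample_tuple n d (S : measurableType d) (Y : 'I_n -> S -> T) :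
  (forall i, measurable_fun setT (Y i)) -> measurable_fun setT (sample_tuple Y).
Proof.
move=> mY; apply/measurable_fun_tnthP => i.
by apply: eq_measurable_fun (mY i) => s _ /=; rewrite tnth_mktuple.
Qed.

Definition rectangle n (B : 'I_n -> set T) : set (n.-tuple T) :=
  \bigcap_(i in [set: 'I_n]) (fun u => tnth u i) @^-1` B i.

Lemma measurable_rectangle n (B : 'I_n -> set T) :
  (forall i, measurable (B i)) -> measurable (rectangle B).
Proof.
move=> mB; apply: fin_bigcap_measurable => // i _.
by rewrite -[X in measurable X]setTI; exact: measurable_tnth.
Qed.

(** Unlike cylinders over a single coordinate, rectangles are stable under intersection; a cylinder
    is a rectangle with full sides elsewhere. *)
Lemma measurable_tuple_rectangle n :
  @measurable _ (n.-tuple T) =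
  <<s [set C | exists2 B : 'I_n -> set T, (forall i, measurable (B i)) & C = rectangle B] >>.
Proof.
apply/seteqP; split; last first.
  apply: smallest_sub; first exact: sigma_algebra_measurable.
  by move=> _ [B mB ->]; exact: measurable_rectangle.
apply: smallest_sub; first exact: smallest_sigma_algebra.
move=> C; rewrite -bigcup_seq/= => -[i _ [B mB <-]]; rewrite setTI.
apply: sub_sigma_algebra; exists (fun j => if j == i then B else setT).
  by move=> j; case: ifP.
apply/seteqP; split=> u /=.
  by move=> Bu j _ /=; case: eqP => [->|].
by move=> /(_ i I) /=; rewrite eqxx.
Qed.

Definition iid_sample n d (S : measurableType d) (P : probability S R)
    (Y : 'I_n -> S -> T) :=
  [/\ forall i, measurable_fun setT (Y i),
      forall i B, measurable B -> P (Y i @^-1` B) = D B &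
      mutually_independent P Y].

(** Independence fixes the probability of every rectangle, and rectangles form a generating
    pi-system. Applied to a doubled sample and its swapped copy. *)
Lemma iid_sample_law n d1 (S1 : measurableType d1) (P1 : probability S1 R)
    d2 (S2 : measurableType d2) (P2 : probability S2 R)
    (Y1 : 'I_n -> S1 -> T) (Y2 : 'I_n -> S2 -> T) (V : set (n.-tuple T)) :
  iid_sample P1 Y1 -> iid_sample P2 Y2 -> measurable V ->
  P1 (sample_tuple Y1 @^-1` V) = P2 (sample_tuple Y2 @^-1` V).
Proof.
move=> [mY1 lY1 iY1] [mY2 lY2 iY2] mV.
pose f1 := MeasurableFun.Pack (MeasurableFun.Class
  (isMeasurableFun.Build _ _ _ _ _ (measurable_sample_tuple mY1))).
pose f2 := MeasurableFun.Pack (MeasurableFun.Class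
  (isMeasurableFun.Build _ _ _ _ _ (measurable_sample_tuple mY2))).
suff : distribution P1 f1 V = distribution P2 f2 V by [].
apply: (measure_unique _ (fun=> setT) (measurable_tuple_rectangle n)) => //.
- move=> _ _ [B1 mB1 ->] [B2 mB2 ->]; exists (fun i => B1 i `&` B2 i).
    by move=> i; exact: measurableI.
  apply/seteqP; split=> u /=.
    by move=> [u1 u2] i _; split; [exact: u1|exact: u2].
  by move=> u12; split=> i _; have [] := u12 i I.
- move=> _; exists (fun=> setT) => //.
  by apply/seteqP; split.
- by rewrite bigcup_const.
- move=> _ [B mB ->]; rewrite /distribution /pushforward.
  have E d (S : measurableType d) (P : probability S R) (Y : 'I_n -> S -> T) :
      (forall i B, measurable B -> P (Y i @^-1` B) = D B) -> mutually_independent P Y ->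
      P (sample_tuple Y @^-1` rectangle B) = (\prod_(i < n) D (B i))%E.
    move=> lY iY; rewrite [X in P X](_ : _ = \bigcap_(j in [set: 'I_n]) (Y j @^-1` B j)).
      by rewrite iY //; apply: eq_bigr => i _; rewrite lY.
    by apply/seteqP; split=> s /= h i _; have := h i I; rewrite /= tnth_mktuple.
  exact: etrans (E _ _ _ _ lY1 iY1) (esym (E _ _ _ _ lY2 iY2)).
- by move=> _; exact: le_lt_trans (@probability_le1 _ _ _ P1 _ measurableT) (ltry _).
Qed.

Lemma iid_sample_involutive n d (S : measurableType d) (P : probability S R)
    (Y : 'I_n -> S -> T) (s : 'I_n -> 'I_n) : involutive s ->
  iid_sample P Y -> iid_sample P (fun i => Y (s i)).
Proof.
move=> sK [mY lY iY]; split=> [i|i B mB|B mB]; [exact: mY|exact: lY|].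
have := iY (fun i => B (s i)) (fun i => mB _).
rewrite [RHS](reindex_inj (inv_inj sK)) /= => iYs.
rewrite [X in P X = _](_ : _ = \bigcap_(j in [set: 'I_n]) (Y j @^-1` B (s j))).
  by rewrite iYs; apply: eq_bigr => i _; rewrite sK.
apply/seteqP; split=> w /= h i _ /=.
  by have := h (s i) I; rewrite /= sK.
by have := h (s i) I; rewrite /= sK.
Qed.

Definition double_sample n (S : Type) (Y : 'I_n -> S -> T) :
    'I_(n + n) -> S * S -> T :=
  fun k z => match fintype.split k with inl j => Y j z.1 | inr j => Y j z.2 end.

Lemma double_sample_lshift n (S : Type) (Y : 'I_n -> S -> T) j :
  double_sample Y (lshift n j) = Y j \o fst.
Proof. by rewrite /double_sample; apply/funext => z; rewrite (unsplitK (inl j)). Qed.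

Lemma double_sample_rshift n (S : Type) (Y : 'I_n -> S -> T) j :
  double_sample Y (rshift n j) = Y j \o snd.
Proof. by rewrite /double_sample; apply/funext => z; rewrite (unsplitK (inr j)). Qed.

Lemma iid_double_sample n d (S : measurableType d) (P : probability S R)
    (Y : 'I_n -> S -> T) :
  iid_sample P Y -> iid_sample (P \x P)%E (double_sample Y).
Proof.
move=> [mY lY iY].
have mYB j B : measurable B -> measurable (Y j @^-1` B).
  by move=> mB; rewrite -[X in measurable X]setTI; exact: mY.
have PPE A B : measurable A -> measurable B ->
    ((P \x P)%E : probability (S * S)%type R) (A `*` B) = (P A * P B)%E.
  by move=> mA mB; exact: product_measure1E.
have fstB j B : (Y j \o fst) @^-1` B = (Y j @^-1` B) `*` [set: S].
  by apply/seteqP; split=> -[x y] //= [].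
have sndB j B : (Y j \o snd) @^-1` B = [set: S] `*` (Y j @^-1` B).
  by apply/seteqP; split=> -[x y] //= [].
split=> [k|k B mB|B mB].
- case: (split_ordP k) => j ->.
    by rewrite double_sample_lshift; exact: measurableT_comp.
  by rewrite double_sample_rshift; exact: measurableT_comp.
- case: (split_ordP k) => j ->.
    rewrite double_sample_lshift fstB PPE //; last exact: mYB.
    by rewrite probability_setT mule1 lY.
  rewrite double_sample_rshift sndB PPE //; last exact: mYB.
  by rewrite probability_setT mul1e lY.
have -> : \bigcap_(k in [set: 'I_(n + n)]) (double_sample Y k @^-1` B k) =
  (\bigcap_(j in [set: 'I_n]) (Y j @^-1` B (lshift n j))) `*`
  (\bigcap_(j in [set: 'I_n]) (Y j @^-1` B (rshift n j))).
  apply/seteqP; split=> -[x y] /=.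
    move=> h; split=> j _ /=.
      by have := h (lshift n j) I; rewrite /= double_sample_lshift.
    by have := h (rshift n j) I; rewrite /= double_sample_rshift.
  move=> [hx hy] k _ /=; case: (split_ordP k) => j ->.
    by rewrite double_sample_lshift; exact: hx.
  by rewrite double_sample_rshift; exact: hy.
have mI b : measurable (\bigcap_(j in [set: 'I_n]) (Y j @^-1` B (b j))).
  by apply: fin_bigcap_measurable => // j _; exact: mYB.
rewrite PPE // !iY // big_split_ord /=; congr (_ * _)%E.
  apply: eq_bigr => j _; rewrite double_sample_lshift fstB.
  by rewrite PPE ?probability_setT ?mule1 //; exact: mYB.
apply: eq_bigr => j _; rewrite double_sample_rshift sndB.
by rewrite PPE ?probability_setT ?mul1e //; exact: mYB.
Qed.

Lemma iid_sample_pair n d (S : measurableType d) (P : probability S R)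
    (Y : 'I_n -> S -> T) i j (A B : set T) :
  iid_sample P Y -> i != j -> measurable A -> measurable B ->
  P (Y i @^-1` A `&` Y j @^-1` B) = (D A * D B)%E.
Proof.
move=> [mY lY iY] ij mA mB.
pose C k := if k == i then A else if k == j then B else setT.
have mC k : measurable (C k) by rewrite /C; case: ifP => // _; case: ifP.
rewrite [X in P X](_ : _ = \bigcap_(k in [set: 'I_n]) (Y k @^-1` C k)); last first.
  apply/seteqP; split=> s /=.
    by move=> [sA sB] k _ /=; rewrite /C; case: eqP => [->//|_]; case: eqP => [->|].
  move=> h; split.
    by have := h i I; rewrite /= /C eqxx.
  by have := h j I; rewrite /= /C eq_sym (negPf ij) eqxx.
rewrite iY // (bigD1 i) //= (bigD1 j) /=; last by rewrite eq_sym.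
rewrite big1 => [|k /andP[ki kj]]; last by rewrite lY // /C (negPf ki) (negPf kj) probability_setT.
by rewrite mule1 !lY // /C eqxx [j == i]eq_sym (negPf ij) eqxx.
Qed.

End ProductLaw.

Section Swap.
Variables (n : nat) (sg : {ffun 'I_n -> bool}).

Definition swap (k : 'I_(n + n)) : 'I_(n + n) :=
  match fintype.split k with
  | inl j => if sg j then rshift n j else lshift n j
  | inr j => if sg j then lshift n j else rshift n j
  end.

Lemma swap_lshift j : swap (lshift n j) = if sg j then rshift n j else lshift n j.
Proof. by rewrite /swap (unsplitK (inl j)). Qed.

Lemma swap_rshift j : swap (rshift n j) = if sg j then lshift n j else rshift n j.
Proof. by rewrite /swap (unsplitK (inr j)). Qed.

Lemma swapK : involutive swap.
Proof.
move=> k; case: (split_ordP k) => j ->; rewrite ?swap_lshift ?swap_rshift.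
  by case E : (sg j); rewrite ?swap_lshift ?swap_rshift E.
by case E : (sg j); rewrite ?swap_lshift ?swap_rshift E.
Qed.

End Swap.

(** * Second moments of sample sums *)

Section Chebyshev.
Variables (R : realType) (dT : measure_display) (T : measurableType dT).
Variables (D : probability T R) (d : measure_display) (S : measurableType d).
Variables (P : probability S R) (n : nat) (Y : 'I_n -> S -> T).
Hypothesis iidY : iid_sample D P Y.

Lemma bounded_integrable d' (S' : measurableType d') (P' : probability S' R)
    (f : S' -> R) (B : R) :
  measurable_fun setT f -> (forall x, `|f x| <= B) -> P'.-integrable setT (EFin \o f).
Proof.
move=> mf fB; apply: measurable_bounded_integrable => //.
  by rewrite (le_lt_trans (probability_le1 _ _)) ?ltry.
exists B; split; first exact: num_real.
by move=> M BM x _; exact: le_trans (fB x) (ltW BM).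
Qed.

(** By uniqueness of product measures the pair has law [D \x D], and Fubini integrates the centred
    factor to 0. *)
Lemma integral_sample_pair (f : T -> R) (B : R) i j :
  measurable_fun setT f -> (forall x, `|f x| <= B) -> i != j ->
  (\int[D]_t (f t)%:E = 0)%E ->
  (\int[P]_s (f (Y i s) * f (Y j s))%:E = 0)%E.
Proof.
move=> mf fB ij f0; have [mY lY _] := iidY.
pose phi s := (Y i s, Y j s).
have mphi : measurable_fun setT phi by exact: measurable_fun_pair.
pose F (z : T * T) := f z.1 * f z.2.
have mF : measurable_fun setT F.
  by apply: measurable_funM; exact: measurableT_comp.
have B0 : 0 <= B.
  by apply: le_trans (fB point).
have FB z : `|F z| <= B * B by rewrite normrM ler_pM.
have mEF : measurable_fun [set: T * T] (EFin \o F : T * T -> \bar R) by exact/measurable_EFinP.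
have := integral_pushforward mphi (mu := P) (D := setT) mEF.
rewrite preimage_setT => E; rewrite -[LHS]E //; last first.
  apply: (@bounded_integrable _ _ _ (F \o phi) (B * B)); first exact: measurableT_comp.
  by move=> x; exact: FB.
pose g := MeasurableFun.Pack (MeasurableFun.Class (isMeasurableFun.Build _ _ _ _ _ mphi)).
have -> : (\int[pushforward P phi]_z (EFin \o F) z = \int[D \x D]_z (EFin \o F) z)%E.
  apply: eq_measure_integral => A mA _.
  apply/esym/(product_measure_unique (m' := distribution P g)) => // A1 A2 mA1 mA2.
  exact: (iid_sample_pair iidY ij mA1 mA2).
rewrite -integral12_prod_meas1; last first.
  exact: (@bounded_integrable _ _ ((D \x D)%E : probability _ R) F (B * B)).
rewrite integral0_eq // => x _; rewrite /fubini_F /F /=.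
under eq_integral do rewrite EFinM.
rewrite integralZl //; last exact: (@bounded_integrable _ _ _ f B).
by rewrite f0 mule0.
Qed.

Lemma integral_sqr_sum_sample (f : T -> R) (B : R) :
  measurable_fun setT f -> (forall x, `|f x| <= B) ->
  (\int[D]_t (f t)%:E = 0)%E ->
  (\int[P]_s ((\sum_i f (Y i s)) ^+ 2)%:E <= (n%:R * B ^+ 2)%:E)%E.
Proof.
move=> mf fB f0; have [mY lY _] := iidY.
have B0 : 0 <= B by apply: le_trans (fB point).
have mfY i : measurable_fun setT (fun s => f (Y i s)) by exact: measurableT_comp.
have intP i j : P.-integrable setT (fun s => (f (Y i s) * f (Y j s))%:E).
  apply: (@bounded_integrable _ _ P (fun s => f (Y i s) * f (Y j s)) (B * B)).
    exact: measurable_funM.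
  by move=> x; rewrite normrM ler_pM.
under eq_integral do rewrite expr2 big_distrlr /= -sumEFin.
rewrite integral_sum //; last first.
  move=> i; under eq_fun do rewrite -sumEFin.
  exact: integrable_sum.
have -> : (n%:R * B ^+ 2)%:E = (\sum_(i < n) (B ^+ 2)%:E)%E.
  by rewrite sumEFin sumr_const card_ord mulr_natl.
apply: lee_sum => i _.
under eq_integral do rewrite -sumEFin.
rewrite integral_sum // (bigD1 i) //= big1 ?adde0; last first.
  by move=> j ji; rewrite (integral_sample_pair mf fB) // eq_sym.
apply: (@le_trans _ _ (\int[P]_s (B ^+ 2)%:E)%E).
  apply: ge0_le_integral => //.
  - by move=> s _; rewrite lee_fin -expr2 sqr_ge0.
  - by apply/measurable_EFinP; exact: measurable_funM.
  - move=> s _; rewrite lee_fin -expr2 -[leLHS]real_normK ?num_real //.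
    by rewrite lerXn2r ?nnegrE.
by rewrite integral_cst //= probability_setT mule1.
Qed.

Lemma chebyshev_sample (f : T -> R) (B eta : R) : (0 < n)%N -> 0 < eta ->
  measurable_fun setT f -> (forall x, 0 <= f x <= B) ->
  (P [set s | (n%:R * eta <=
      `|\sum_i f (Y i s) - n%:R * fine (\int[D]_t (f t)%:E)%E|)%R] <= (B ^+ 2 / (n%:R * eta ^+ 2))%:E)%E.
Proof.
move=> n0 eta0 mf fB; have [mY lY _] := iidY.
have fnB x : `|f x| <= B by have /andP[f0 ?] := fB x; rewrite ger0_norm.
have B0 : 0 <= B by apply: le_trans (fnB point).
have intf := bounded_integrable D mf fnB.
set mu := fine _.
have muE : (\int[D]_t (f t)%:E = mu%:E)%E by rewrite fineK // integrable_fin_num.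
(* The mean lies in [[0, B]] too, so the centred function is bounded by [B] and not merely by
   [2 B]. *)
have mu0B : 0 <= mu <= B.
  rewrite -!lee_fin -muE; apply/andP; split.
    by apply: integral_ge0 => t _; rewrite lee_fin; have /andP[] := fB t.
  apply: (@le_trans _ _ (\int[D]_t B%:E)%E).
    apply: ge0_le_integral => //.
    - by move=> t _; rewrite lee_fin; have /andP[] := fB t.
    - exact/measurable_EFinP.
    - by move=> t _; rewrite lee_fin; have /andP[] := fB t.
  by rewrite integral_cst //= probability_setT mule1.
pose h t := f t - mu.
have mh : measurable_fun setT h by exact: measurable_funB.
have hB x : `|h x| <= B.
  by have := fB x; rewrite /h ler_norml => /andP[? ?]; move: mu0B => /andP[? ?]; apply/andP; split; lra.
have h0 : (\int[D]_t (h t)%:E = 0)%E.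
  rewrite /h; under eq_integral do rewrite EFinB.
  rewrite integralB_EFin //=; last exact: (@bounded_integrable _ _ D (cst mu) `|mu|).
  by rewrite muE integral_cst //= probability_setT mule1 subee.
have sE s : \sum_i f (Y i s) - n%:R * mu = \sum_i h (Y i s).
  by rewrite /h sumrB sumr_const card_ord mulr_natl.
pose G s := \sum_i h (Y i s).
have mG : measurable_fun setT G.
  by apply: measurable_sum => i; exact: measurableT_comp.
have neta : 0 < n%:R * eta by rewrite mulr_gt0 // ltr0n.
set A := [set s | _].
have mA : measurable A.
  rewrite /A; under eq_set do rewrite sE.
  apply/measurable_set_bool/measurable_fun_ler => //.
  exact: measurableT_comp.
have : (((n%:R * eta) ^+ 2)%:E * P A <= (n%:R * B ^+ 2)%:E)%E.
  apply: le_trans (integral_sqr_sum_sample mh hB h0).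
  have mA1 : measurable_fun setT (fun s => (\1_A s)%:E : \bar R).
    by apply/measurable_EFinP; exact: measurable_indic.
  rewrite -[X in (_ * P X)%E]setIT -integral_indic //.
  rewrite -(ge0_integralZl_EFin _ _ (fun s _ => _) mA1 (sqr_ge0 _)) //.
  apply: ge0_le_integral => //.
  - by move=> s _; rewrite lee_fin mulr_ge0 ?sqr_ge0.
  - apply/measurable_EFinP/measurable_funM => //; exact: measurable_indic.
  - by apply/measurable_EFinP; exact: (measurable_funX 2 mG).
  move=> s _; rewrite lee_fin indicE; have [|] := boolP (s \in A).
    rewrite inE /A /= sE mulr1 -/(G s) => As.
    by rewrite -[leRHS]real_normK ?num_real // lerXn2r ?nnegrE // ltW.
  by rewrite mulr0 sqr_ge0.
rewrite -[P A]fineK ?fin_num_measure // -EFinM !lee_fin => le.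
have n0R : 0 < n%:R :> R by rewrite ltr0n.
rewrite ler_pdivlMr ?mulr_gt0 ?exprn_gt0 //.
rewrite -(ler_pM2l n0R); apply: le_trans le.
by rewrite [leLHS](_ : _ = (n%:R * eta) ^+ 2 * fine (P A)) //; ring.
Qed.

End Chebyshev.

(** * Uniform deviation *)

Section UniformDeviation.
Variables (R : realType) (dT : measure_display) (T : measurableType dT).
Variables (D : probability T R) (Theta : Type) (Th : set Theta) (Q : finType).
Variables (pat : T -> Theta -> Q) (val : T -> Q -> R) (B : R) (M d : nat).
Hypotheses (B0 : 0 < B) (M0 : (0 < M)%N) (d0 : (0 < d)%N).
Hypothesis valB : forall t q, 0 <= val t q <= B.
Hypothesis mval : forall q, measurable_fun setT (val^~ q).
Hypothesis mpat : forall th q, measurable [set t | pat t th = q].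

(** One parameter must produce the pattern on all points at once. This replaces a quantifier over
    [Th] by finitely many events, one for each [p]. *)
Definition realizable n (u : n.-tuple T) (p : {ffun 'I_n -> Q}) :=
  exists th, Th th /\ forall i, pat (tnth u i) th = p i.

Hypothesis mrealizable : forall n (p : {ffun 'I_n -> Q}),
  measurable [set u : n.-tuple T | realizable u p].
Hypothesis growth : forall n (u : n.-tuple T) (S : {set {ffun 'I_n -> Q}}),
  (forall p, p \in S -> realizable u p) -> (#|S| <= (n * M).+1 ^ d)%N.

Lemma measurable_loss th : measurable_fun setT (fun t => val t (pat t th)).
Proof.
have -> : (fun t => val t (pat t th)) =
    (fun t => \sum_q \1_[set t | pat t th = q] t * val t q).
  apply/funext => t; rewrite (bigD1 (pat t th)) //= indicE mem_set // mul1r.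
  rewrite big1 ?addr0 // => q qt; rewrite indicE memNset ?mul0r //= => tq.
  by move: qt; rewrite tq eqxx.
apply: measurable_sum => q; apply: measurable_funM => //.
Qed.

Variables (m : nat) (eta delta : R) (Y : nat).
Hypotheses (m0 : (0 < m)%N) (eta0 : 0 < eta) (delta1 : delta <= 1) (Y0 : (0 < Y)%N).
Hypothesis packY : forall k, (4 * (14 * d * M * 4 ^ k) ^ (2 * d) <= Y ^ k.+1)%N.
Hypothesis expY :
  Y%:R ^+ 2 * expR (- (m%:R * eta ^+ 2 / (72 * 80 * B ^+ 2))) <= delta / 8.

(** The pattern is an argument separate from any parameter: for fixed [p] the gap is measurable in
    [u], and [ghost_deviation] is a finite union over [p]. *)
Definition ghost_gap (p : {ffun 'I_(m + m) -> Q}) (u : (m + m).-tuple T) : R :=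
  \sum_(j < m) (val (tnth u (rshift m j)) (p (rshift m j))
    - val (tnth u (lshift m j)) (p (lshift m j))).

Definition ghost_deviation : set ((m + m).-tuple T) :=
  \bigcup_(p in [set: {ffun 'I_(m + m) -> Q}])
    ([set u | realizable u p] `&` [set u | m%:R * eta < `|ghost_gap p u|]).

Lemma measurable_ghost_deviation : measurable ghost_deviation.
Proof.
apply: fin_bigcup_measurable => // p _; apply: measurableI; first exact: mrealizable.
apply/measurable_set_bool/measurable_fun_ltr => //.
apply: measurableT_comp => //; apply: measurable_sum => j.
apply: measurable_funB; apply: (@measurableT_comp _ _ _ _ _ _ (val^~ _)) => //;
  exact: measurable_tnth.
Qed.

Definition swap_tuple (u : (m + m).-tuple T) sg :=
  [tuple tnth u (swap sg k) | k < m + m].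

(** For a fixed doubled sample, exchanging the [j]-th point with its ghost flips the sign of the
    [j]-th term of the gap, so bad swaps are counted by the chaining bound. The coefficients [a j]
    lie in [[-B, B]], being differences of values in [[0, B]]. *)
Lemma card_ghost_deviation_swap (u : (m + m).-tuple T) :
  #|[set sg | `[< ghost_deviation (swap_tuple u sg) >]]%SET|%:R <= delta / 2 * 2 ^+ m.
Proof.
pose X := [set p : {ffun 'I_m -> Q * Q} | `[< exists th, Th th /\ forall j,
  p j = (pat (tnth u (lshift m j)) th, pat (tnth u (rshift m j)) th) >]]%SET.
pose a j (q : Q * Q) := val (tnth u (rshift m j)) q.2 - val (tnth u (lshift m j)) q.1.
have aB j q : `|a j q| <= B.
  have := valB (tnth u (rshift m j)) q.2; have := valB (tnth u (lshift m j)) q.1.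
  by rewrite /a ler_norml => /andP[? ?] /andP[? ?]; apply/andP; split; lra.
have XY k (S : {set {ffun 'I_m -> Q * Q}}) : S \subset X -> separated (4 ^ k) S ->
    (#|S| <= Y ^ k.+1)%N.
  move=> SX sepS; apply: leq_trans (packY k).
  apply: (@packing_bound _ _ X) => //; rewrite ?expn_gt0 //; last first.
    move=> p p' pS p'S pp'; move/forall_inP : sepS => /(_ _ pS) /forall_inP /(_ _ p'S).
    by rewrite pp'.
  move=> l io; set I' := imset _ _.
  (* Patterns of [l] pairs are patterns of [2l] single points, whence the [2 * l] in the growth
     condition of [packing_bound]; [io] may repeat indices, as [growth] covers every tuple. *)
  pose merge (r : {ffun 'I_l -> Q * Q}) : {ffun 'I_(l + l) -> Q} :=
    [ffun k => match fintype.split k with inl i => (r i).1 | inr i => (r i).2 end].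
  have merge_inj : injective merge.
    move=> r1 r2 /ffunP e; apply/ffunP => i; apply: injective_projections.
      by have := e (lshift l i); rewrite !ffunE (unsplitK (inl i)).
    by have := e (rshift l i); rewrite !ffunE (unsplitK (inr i)).
  pose u' := [tuple match fintype.split k with inl i => tnth u (lshift m (io i))
    | inr i => tnth u (rshift m (io i)) end | k < l + l].
  rewrite mul2n -addnn -(card_imset _ merge_inj); apply: (growth (u := u')).
  move=> q /imsetP[r /imsetP[p]]; rewrite finset.inE => /asboolP[th [Tth pth]] -> ->.
  exists th; split=> // k'; rewrite tnth_mktuple ffunE.
  by case: (fintype.split k') => i; rewrite ffunE pth.
apply: le_trans (card_sup_signed_sum_gt B0 aB m0 eta0 delta1 Y0 XY expY).
rewrite ler_nat; apply/subset_leq_card/fintype.subsetP => sg.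
rewrite !finset.inE => /asboolP[p _ [[th [Tth pth]] gap]].
apply/exists_inP; exists [ffun j => (pat (tnth u (lshift m j)) th,
    pat (tnth u (rshift m j)) th)].
  by rewrite finset.inE; apply/asboolP; exists th; split=> // j; rewrite ffunE.
apply: lt_le_trans gap _; rewrite le_eqVlt; apply/orP; left; apply/eqP; congr (`|_|).
apply: eq_bigr => j _; rewrite -!pth !tnth_mktuple swap_lshift swap_rshift ffunE /a /=.
by case: (sg j); rewrite ?expr1 ?expr0 ?mul1r ?mulN1r ?opprB.
Qed.

Variables (dO : measure_display) (Omega : measurableType dO).
Variables (P : probability Omega R) (X : 'I_m -> Omega -> T).
Hypothesis iidX : iid_sample D P X.

Let Z := double_sample X.
Let W : set (Omega * Omega) := sample_tuple Z @^-1` ghost_deviation.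

Lemma measurable_ghost_event : measurable W.
Proof.
have [mZ _ _] := iid_double_sample iidX.
rewrite -[X in measurable X]setTI; apply: measurable_sample_tuple => //.
exact: measurable_ghost_deviation.
Qed.

(** Swaps preserve the law of the doubled sample, so [2^m] times the probability of [W] is the
    integral of the number of bad swaps, which is pointwise at most [delta / 2 * 2^m]. *)
Lemma ghost_deviation_probability : ((P \x P)%E W <= (delta / 2)%:E)%E.
Proof.
pose PP : probability (Omega * Omega)%type R := (P \x P)%E.
have iidZ : iid_sample D PP Z by exact: iid_double_sample.
have [mZ _ _] := iidZ.
pose Wsg sg := sample_tuple (fun k => Z (swap sg k)) @^-1` ghost_deviation.
have mWsg sg : measurable (Wsg sg).
  rewrite -[X in measurable X]setTI; apply: measurable_sample_tuple => //.
  exact: measurable_ghost_deviation.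
have mW := measurable_ghost_event.
have WE sg : PP W = PP (Wsg sg).
  apply: (iid_sample_law iidZ _ measurable_ghost_deviation).
  exact: iid_sample_involutive (swapK sg) iidZ.
have m1W sg : measurable_fun setT (fun z => (\1_(Wsg sg) z)%:E : \bar R).
  by apply/measurable_EFinP; exact: measurable_indic.
have intW sg : (\int[PP]_z (\1_(Wsg sg) z)%:E = PP (Wsg sg))%E.
  exact: etrans (integral_indic PP measurableT (mWsg sg)) (congr1 PP (setIT _)).
have : ((2 ^+ m)%:E * PP W <= (delta / 2 * 2 ^+ m)%:E)%E.
  have -> : ((2 ^+ m)%:E * PP W = \sum_(sg : {ffun 'I_m -> bool}) PP (Wsg sg))%E.
    under eq_bigr do rewrite -WE.
    rewrite -[PP W]fineK ?fin_num_measure //.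
    rewrite sumEFin sumr_const card_ffun card_bool card_ord -EFinM.
    by congr (_%:E); rewrite -[RHS]mulr_natl natrX.
  have -> : (\sum_(sg : {ffun 'I_m -> bool}) PP (Wsg sg) =
      \int[PP]_z (\sum_(sg : {ffun 'I_m -> bool}) (\1_(Wsg sg) z)%:E))%E.
    rewrite (ge0_integral_sum PP measurableT m1W) => [|sg z _]; last by rewrite lee_fin.
    by apply: eq_bigr => sg _; exact/esym/intW.
  apply: (@le_trans _ _ (\int[PP]_z (delta / 2 * 2 ^+ m)%:E)%E).
    apply: ge0_le_integral => //.
    - by move=> z _; apply: sume_ge0 => sg _; rewrite lee_fin.
    - by apply: emeasurable_sum => sg; exact: m1W.
    move=> z _; rewrite sumEFin lee_fin.
    apply: le_trans (card_ghost_deviation_swap (sample_tuple Z z)).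
    rewrite -sum1_card natr_sum [leRHS]big_mkcond; apply: ler_sum => sg _ /=.
    have Esw : swap_tuple (sample_tuple Z z) sg = sample_tuple (fun k => Z (swap sg k)) z.
      by apply: eq_from_tnth => k; rewrite !tnth_mktuple.
    rewrite finset.inE Esw indicE; case: asboolP => h.
      by rewrite mem_set.
    by rewrite memNset.
  by rewrite integral_cst //= probability_setT mule1.
change (((2 ^+ m)%:E * PP W <= (delta / 2 * 2 ^+ m)%:E)%E -> (PP W <= (delta / 2)%:E)%E).
rewrite -[PP W]fineK ?fin_num_measure //.
by rewrite -EFinM !lee_fin mulrC ler_pM2r ?exprn_gt0.
Qed.

(** The good event asks that a ghost sample yield a large gap with probability below [1/2]; Fubini
    and Markov turn [delta / 2] into [delta]. If such a [w] were off by more than [2 m eta] at some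
    [th], Chebyshev at this single [th] would place the ghost sum within [m eta] of its mean with
    probability at least [1/2], forcing a gap above [m eta]. *)
Lemma uniform_deviation : 2 * B ^+ 2 <= m%:R * eta ^+ 2 ->
  exists E : set Omega, [/\ measurable E, ((1 - delta)%:E <= P E)%E &
    forall w, E w -> forall th, Th th ->
      `|\sum_(j < m) val (X j w) (pat (X j w) th)
        - m%:R * fine (\int[D]_t (val t (pat t th))%:E)%E| <= 2 * (m%:R * eta)].
Proof.
move=> mB; have mW := measurable_ghost_event; have [mX _ _] := iidX.
pose g w := P (xsection W w).
have mg : measurable_fun [set: Omega] g by exact: measurable_fun_xsection.
have mE : measurable [set w | (g w < (2^-1)%:E)%E].
  exact/measurable_set_bool/measurable_fun_lte.
exists [set w | (g w < (2^-1)%:E)%E]; split=> //.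
  set E := [set w | _] in mE *.
  have EC : (P (~` E) <= delta%:E)%E.
    have mCE : measurable (~` E) by exact: measurableC.
    have : ((2^-1)%:E * P (~` E) <= (delta / 2)%:E)%E.
      apply: le_trans ghost_deviation_probability.
      rewrite -[X in (_ * P X)%E]setIT -(integral_indic P measurableT mCE).
      have m1 : measurable_fun setT (fun w => (\1_(~` E) w)%:E : \bar R).
        by apply/measurable_EFinP; exact: measurable_indic.
      have i2 : 0 <= 2^-1 :> R by rewrite invr_ge0.
      rewrite -(ge0_integralZl_EFin _ _ (fun w _ => _) m1 i2) //.
      apply: ge0_le_integral => //.
      - by apply: measurable_funeM.
      move=> w _ /=; rewrite indicE; have [|_] := boolP (w \in ~` E); last by rewrite mule0.
      by rewrite inE /E /= mule1 => /negP; rewrite -leNgt.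
    rewrite -[P (~` E)]fineK ?fin_num_measure // -EFinM !lee_fin; lra.
  have -> : P E = (1 - P (~` E))%E.
    by rewrite probability_setC // -[P E]fineK ?fin_num_measure // -!EFinB; congr (_%:E); lra.
  by rewrite EFinB leeB.
move=> w Ew th Tth; rewrite leNgt; apply/negP => big.
set mu := fine _ in big.
have lossB t : 0 <= val t (pat t th) <= B by exact: valB.
have ch := chebyshev_sample iidX m0 eta0 (measurable_loss th) lossB.
rewrite -/mu in ch; set A := [set s | _] in ch.
have mA : measurable A.
  apply/measurable_set_bool/measurable_fun_ler => //; apply: measurableT_comp => //.
  apply: measurable_funB => //; apply: measurable_sum => j.
  exact: (measurableT_comp (measurable_loss th) (mX j)).
have mR0 : 0 < m%:R :> R by rewrite ltr0n.
have PA : (P A <= (2^-1)%:E)%E.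
  apply: le_trans ch _; rewrite lee_fin ler_pdivrMr ?mulr_gt0 ?exprn_gt0 //.
  by rewrite mulrC; lra.
have sub : ~` A `<=` xsection W w.
  move=> w' /= /negP; rewrite -ltNge => small; rewrite /xsection /= inE /W /=.
  exists [ffun k => pat (tnth (sample_tuple Z (w, w')) k) th] => //; split=> /=.
    by exists th; split=> // k; rewrite ffunE.
  have -> : ghost_gap [ffun k => pat (tnth (sample_tuple Z (w, w')) k) th]
      (sample_tuple Z (w, w')) = \sum_(j < m) val (X j w') (pat (X j w') th) -
        \sum_(j < m) val (X j w) (pat (X j w) th).
    rewrite -sumrB; apply: eq_bigr => j _; rewrite !ffunE !tnth_mktuple /Z.
    by rewrite double_sample_lshift double_sample_rshift.
  move: big small; set a := \sum_(j < m) _; set b := \sum_(j < m) _ => big small.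
  have := ler_distD b a (m%:R * mu); rewrite [`|a - b|]distrC.
  set x1 := `|a - _| in big *; set x2 := `|b - _ * _| in small *; set x3 := `|b - a|.
  by lra.
have := Ew; rewrite /= /g ltNge => /negP; apply.
apply: (@le_trans _ _ (P (~` A))); last first.
  by apply: le_measure; rewrite ?inE //; [exact: measurableC|exact: measurable_xsection].
rewrite probability_setC //; move: PA; rewrite -[P A]fineK ?fin_num_measure //.
by rewrite -EFinB !lee_fin; lra.
Qed.

End UniformDeviation.

(** * Measurability of affine feasibility *)

Section AffineFeasibility.
Import numFieldNormedType.Exports.
Variables (R : realType) (A : finType) (H : R).
Implicit Types th : A -> R.

(** A cluster point stands in for the limit of a subsequence: arbitrarily late terms come
    arbitrarily close to it. *)
Lemma box_cluster (th : nat -> A -> R) : (forall k, subsidy H (th k)) ->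
  exists2 th', subsidy H th' & forall e : R, 0 < e -> forall K : nat,
    exists2 k, (K <= k)%N & forall a, `|th' a - th k a| <= e.
Proof.
move=> thH.
pose v k : 'rV[R]_#|A| := \row_i th k (enum_val i).
pose box := [set w : 'rV[R]_#|A| | forall i, `[0, H]%classic (w ord0 i)].
have cbox : compact box.
  exact: (@rV_compact R #|A| (fun=> `[0, H]%classic) (fun=> @segment_compact R 0 H)).
have [|w [wbox wcl]] := cbox (v @ \oo) _.
  by exists 0%N => // k _ i /=; rewrite mxE in_itv /=; exact: thH.
exists (fun a => w ord0 (enum_rank a)) => [a|e e0 K].
  by have := wbox (enum_rank a); rewrite /= in_itv.
have [|u [[k /= Kk <-] wk]] := wcl [set v k | k in [set k | (K <= k)%N]] _ _ (nbhsx_ballx w e e0).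
  by exists K => // k /= Kk; exists k.
exists k => // a; have [_ /(_ ord0 (enum_rank a))] := wk.
by rewrite /ball /= mxE enum_rankK => /ltW.
Qed.

Variable L : finType.
Variable al : L -> A -> R.

Definition affine (be : L -> R) th l := \sum_a al l a * th a + be l.

Lemma affine_lipschitz (be : L -> R) th th' l (e : R) :
  (forall a, `|th a - th' a| <= e) ->
  `|affine be th l - affine be th' l| <= (\sum_a `|al l a|) * e.
Proof.
move=> the; rewrite /affine opprD addrACA subrr addr0 -sumrB mulr_suml.
apply: le_trans (ler_norm_sum _ _ _) _; apply: ler_sum => a _.
by rewrite -mulrBr normrM ler_wpM2l.
Qed.

Variable b : L -> bool.

(** Strict positivity is not a closed condition, so a form with [b l] false must reach [lo]. A
    positive [lo] encodes strictness; lowering [lo] and raising [hi] gives slack. *)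
Definition relaxed (be : L -> R) th (lo hi : R) :=
  [forall l, if b l then affine be th l <= hi else lo <= affine be th l].

Let K := \sum_l \sum_a `|al l a|.

Lemma affine_lipschitz_sum (be : L -> R) th th' l (e : R) : 0 <= e ->
  (forall a, `|th a - th' a| <= e) ->
  `|affine be th l - affine be th' l| <= K * e.
Proof.
move=> e0 /affine_lipschitz/le_trans; apply; apply: ler_wpM2r => //.
by rewrite /K (bigD1 l) //= lerDl; apply: sumr_ge0 => *; exact: sumr_ge0.
Qed.

(** Compactness: solutions with slack tending to 0 cluster at a subsidy, and the Lipschitz bound
    carries the constraints over to it. *)
Lemma relaxed_cluster (be : L -> R) (lo hi : R) :
  (forall e : R, 0 < e -> exists2 th, subsidy H th & relaxed be th (lo - e) (hi + e)) ->
  exists2 th, subsidy H th & relaxed be th lo hi.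
Proof.
move=> ex.
have K0 : 0 <= K by apply: sumr_ge0 => l _; exact: sumr_ge0.
have exk k : exists th : A -> R, subsidy H th /\
    relaxed be th (lo - k.+1%:R^-1) (hi + k.+1%:R^-1).
  by have [|th ? ?] := ex k.+1%:R^-1; [rewrite invr_gt0|exists th].
have [th thP] := choice exk.
have [th' th'H cl] := box_cluster (fun k => (thP k).1).
exists th' => //; apply/forallP => l.
have near (e : R) : 0 < e -> exists2 k,
    k.+1%:R^-1 <= e & `|affine be th' l - affine be (th k) l| <= K * e.
  move=> e0; have [k0 _ k0e] := near_infty_natSinv_lt (PosNum e0).
  have [k k0k thk] := cl e e0 k0; exists k.
    by have := k0e k k0k; exact: ltW.
  exact: affine_lipschitz_sum (ltW e0) thk.
(* [K] may be 0, so the error is split as [K e' + e' = e] with [e' = e / (K + 1)]. *)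
have K1 : 0 < K + 1 by rewrite ltr_wpDl.
case: ifPn => bl; apply/ler_addgt0Pr => e e0; pose e' := e / (K + 1).
- have e'0 : 0 < e' by rewrite divr_gt0.
  have [k ke nk] := near e' e'0; have [_ /forallP/(_ l)] := thP k; rewrite bl => hk.
  have : K * e' + e' = e by rewrite -{2}[e']mul1r -mulrDl /e' mulrC mulfVK // gt_eqF.
  move: nk hk ke; rewrite ler_norml => /andP[].
  by move: (affine _ _ l) (affine _ _ l) (K * e') (_^-1) => x y z t; lra.
- have e'0 : 0 < e' by rewrite divr_gt0.
  have [k ke nk] := near e' e'0; have [_ /forallP/(_ l)] := thP k; rewrite (negPf bl) => hk.
  have : K * e' + e' = e by rewrite -{2}[e']mul1r -mulrDl /e' mulrC mulfVK // gt_eqF.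
  move: nk hk ke; rewrite ler_norml => /andP[].
  by move: (affine _ _ l) (affine _ _ l) (K * e') (_^-1) => x y z t; lra.
Qed.

(** There are [k.+2] nodes so that both [0] and [H] are among them. *)
Definition grid k (g : {ffun A -> 'I_k.+2}) : A -> R :=
  fun a => H * ((g a)%:R / k.+1%:R).

Lemma grid_subsidy k g : 0 <= H -> subsidy H (@grid k g).
Proof.
move=> H0 a; rewrite /grid mulr_ge0 ?divr_ge0 //= ler_piMr // ler_pdivrMr ?mul1r //.
by rewrite ler_nat -ltnS.
Qed.

Lemma grid_near k th : subsidy H th ->
  exists g : {ffun A -> 'I_k.+2}, forall a, `|th a - grid g a| <= H / k.+1%:R.
Proof.
move=> thH.
have k0 : 0 < k.+1%:R :> R by [].
exists [ffun a => inord (Num.truncn (th a / H * k.+1%:R))] => a.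
have /andP[tha0 thaH] := thH a.
have [H0|H0] := eqVneq H 0.
  have -> : th a = 0 by apply/le_anti; rewrite tha0 -[X in _ <= X]H0 thaH.
  by rewrite /grid H0 !mul0r subrr normr0.
have Hgt : 0 < H by rewrite lt0r H0 (le_trans tha0 thaH).
set x := th a / H * k.+1%:R.
have x0 : 0 <= x by rewrite mulr_ge0 ?divr_ge0 // ltW.
have xk : x <= k.+1%:R by rewrite /x ler_piMl // ler_pdivrMr ?mul1r.
have /andP[tx xt] := truncn_itv x0.
have tk : (Num.truncn x < k.+2)%N by rewrite ltnS -(ler_nat R) (le_trans tx).
rewrite /grid ffunE -/x inordK //.
have -> : th a = H * (x / k.+1%:R).
  by rewrite /x mulfK ?gt_eqF // mulrC mulfVK.
rewrite -mulrBr -mulrBl normrM (ger0_norm (ltW Hgt)).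
apply: ler_wpM2l; first exact: ltW.
have k1 : 0 <= k.+1%:R^-1 :> R by rewrite invr_ge0.
rewrite normrM (ger0_norm k1) ler_piMl //.
by rewrite ger0_norm ?subr_ge0 // lerBlDr -[X in _ <= X + _]/(1%:R) -natrD add1n ltW.
Qed.

Variables (d : measure_display) (S : measurableType d) (be : S -> L -> R).
Hypothesis mbe : forall l, measurable_fun setT (be^~ l).

Lemma measurable_relaxed th lo hi : measurable [set s | relaxed (be s) th lo hi].
Proof.
apply/measurable_set_bool/measurable_forall => l.
by case: (b l); apply: measurable_fun_ler => //; apply: measurable_funD.
Qed.

(** A solution exists iff, for every [k], some grid point solves the constraints up to the rounding
    error [K H / (k+1)]: rounding gives one direction, compactness the other. The coefficients [al]
    do not depend on [s], so one error bound serves all [s]. *)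
Lemma measurable_exists_relaxed lo hi : 0 <= H ->
  measurable [set s | exists2 th, subsidy H th & relaxed (be s) th lo hi].
Proof.
move=> H0.
have K0 : 0 <= K by apply: sumr_ge0 => l _; exact: sumr_ge0.
rewrite [X in measurable X](_ : _ = \bigcap_k \bigcup_(g in [set: {ffun A -> 'I_k.+2}])
    [set s | relaxed (be s) (grid g) (lo - K * (H / k.+1%:R)) (hi + K * (H / k.+1%:R))]).
  apply: bigcap_measurable => [|k _]; first by exists 0%N.
  by apply: fin_bigcup_measurable => // g _; exact: measurable_relaxed.
apply/seteqP; split=> s /=.
  move=> [th thH rth] k _; have [g gth] := grid_near k thH; exists g => //=.
  apply/forallP => l; have Hk : 0 <= H / k.+1%:R by rewrite divr_ge0.
  have := affine_lipschitz_sum (be s) l Hk gth; rewrite ler_norml => /andP[].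
  move/forallP : rth => /(_ l).
  by move: (affine _ _ l) (affine _ th l) (K * _) => x y z; case: ifP => _; lra.
move=> h; apply: relaxed_cluster => e e0.
have [k _ ke] := near_infty_natSinv_lt (PosNum (divr_gt0 e0 (ltr_wpDl (mulr_ge0 K0 H0) ltr01))).
have [g _ rg] := h k I; exists (grid g); first exact: grid_subsidy.
apply/forallP => l; move/forallP : rg => /(_ l).
have : K * (H / k.+1%:R) <= e.
  have := ltW (ke k (leqnn k)); rewrite /= ler_pdivlMr; last by rewrite ltr_wpDl // mulr_ge0.
  have : 0 <= k.+1%:R^-1 :> R by rewrite invr_ge0.
  by rewrite mulrA; move: k.+1%:R^-1 => z; nra.
by move: (affine _ _ l) (K * _) => x y; case: ifP => _; lra.
Qed.

(** Finitely many strict forms have a positive minimum, which exceeds some [1 / (n+1)]; hence a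
    countable union of closed problems. *)
Lemma measurable_exists_affine : 0 <= H ->
  measurable [set s | exists th, subsidy H th /\
    forall l, b l = (affine (be s) th l <= 0)].
Proof.
move=> H0.
rewrite [X in measurable X](_ : _ = \bigcup_n
    [set s | exists2 th, subsidy H th & relaxed (be s) th n.+1%:R^-1 0]).
  by apply: bigcup_measurable => n _; exact: measurable_exists_relaxed.
apply/seteqP; split=> s /=; last first.
  move=> [n _ [th thH /forallP rth]]; exists th; split=> // l; have := rth l.
  case: (b l) => [->//|le]; apply/esym/negbTE; rewrite -ltNge.
  by apply: lt_le_trans le; rewrite invr_gt0.
(* The default [1] keeps the minimum positive when no form is strict. *)
move=> [th [thH bth]]; pose e := \big[Num.min/1]_(l | ~~ b l) affine (be s) th l.
have e0 : 0 < e by apply/bigmin_gtP; split=> // l; rewrite bth -ltNge.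
have [n _ ne] := near_infty_natSinv_lt (PosNum e0).
exists n => //; exists th => //; apply/forallP => l; case: ifPn => [|bl].
  by rewrite bth.
by apply: le_trans (ltW (ne n (leqnn n))) _; exact: bigmin_le_cond.
Qed.

End AffineFeasibility.

(** * Fair cost-sharing games *)

Section Game.
Variables (R : realType) (N : nat) (A : finType).
Implicit Types (f : A -> {set 'I_N}) (c th : A -> R) (s : joint N A).

Lemma nusers_le s a : (nusers s a <= N)%N.
Proof. by apply: leq_trans (max_card _) _; rewrite card_ord. Qed.

Definition social_cost c s : R := \sum_(i < N) c (s i) / (nusers s (s i))%:R.

Lemma costS_subs c th s : costS c th s + subs th s = social_cost c s.
Proof.
rewrite -big_split /=; apply: eq_bigr => i _.
by rewrite /agent_cost -mulrDl subrK.
Qed.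

Lemma social_cost_le c s (H : R) : (forall a, 0 <= c a <= H) ->
  social_cost c s <= #|A|%:R * H.
Proof.
move=> cH; rewrite /social_cost (partition_big s xpredT) //=.
rewrite mulr_natl -sumr_const; apply: ler_sum => a _.
have /andP[ca0 caH] := cH a; apply: le_trans caH.
rewrite (eq_bigr (fun=> c a / (nusers s a)%:R)) => [|i /eqP -> //].
rewrite sumr_const (_ : #|_| = nusers s a); last first.
  by apply: eq_card => i; rewrite unfold_in /=; apply/eqP/idP; rewrite inE //= => /eqP.
case: (nusers s a) => [|k]; first by rewrite mulr0n.
by rewrite -[leLHS]mulr_natr mulfVK.
Qed.

(** The entry [(a, a', (k, k'))] compares sharing [a] among [k] users with sharing [a'] among [k'].
    All entries are tabulated, attained or not, so the index set is the same for every game. *)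
Definition comparison := (A * A * ('I_N.+1 * 'I_N.+1))%type.

Definition comparisons c th : {ffun comparison -> bool} :=
  [ffun x : comparison => (c x.1.1 - th x.1.1) / x.2.1%:R <= (c x.1.2 - th x.1.2) / x.2.2%:R].

Definition is_NE_of f (q : {ffun comparison -> bool}) s :=
  feasible f s && [forall i, forall a, (i \in f a) ==>
    q (s i, a, (inord (nusers s (s i)), inord (nusers (deviate s i a) a)))].

Lemma is_NE_comparisons f c th s : is_NE f c th s = is_NE_of f (comparisons c th) s.
Proof.
congr (_ && _); apply: eq_forallb => i; apply: eq_forallb => a; congr (_ ==> _).
rewrite ffunE /= !inordK ?ltnS ?nusers_le // /agent_cost.
by have -> : deviate s i a i = a by rewrite ffunE eqxx.
Qed.

Definition loss_of f c (q : {ffun comparison -> bool}) : R :=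
  \big[Num.max/0]_(s : joint N A) (if is_NE_of f q s then social_cost c s else 0).

Lemma loss_prior_comparisons f c th :
  loss_prior f c th = loss_of f c (comparisons c th).
Proof.
rewrite /loss_prior bigmax_mkcond; apply: eq_bigr => s _.
by rewrite is_NE_comparisons costS_subs.
Qed.

Lemma loss_of_bounds f c q (H : R) : (forall a, 0 <= c a <= H) ->
  0 <= loss_of f c q <= #|A|%:R * H.
Proof.
move=> cH; apply/andP; split; first exact: bigmax_ge_id.
have H0 : 0 <= #|A|%:R * H.
  have [A0|/card_gt0P[a _]] := posnP #|A|; first by rewrite A0 mul0r.
  by rewrite mulr_ge0 //; have /andP[] := cH a; exact: le_trans.
by apply: bigmax_le => // s _; case: ifP => // _; exact: social_cost_le.
Qed.

(** With at most one action every deviation is void, and with no agents there is none, so the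
    equilibria are the feasible joint actions. These cases are set apart because [ln (|A| N)] need
    not be positive in them. *)
Lemma loss_prior_constant f c th1 th2 : (#|A| <= 1)%N || (N == 0)%N ->
  loss_prior f c th1 = loss_prior f c th2.
Proof.
move=> deg; rewrite !loss_prior_comparisons; apply: eq_bigr => s _.
rewrite -!is_NE_comparisons /is_NE; congr (if _ && _ then _ else _).
apply: eq_forallb => i; apply: eq_forallb => a; congr (_ ==> _).
case/orP: deg => [A1|/eqP N0]; last by have := ltn_ord i; rewrite [X in (_ < X)%N]N0.
have -> : deviate s i a = s.
  by apply/ffunP => j; rewrite ffunE; case: eqP => // _; apply: (card_le1_eqP A1).
by rewrite !lexx.
Qed.

(** The slopes depend on the comparison alone; the game enters only through [comparison_const]. This
    provides the sample-independent coefficients [al]. *)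
Definition comparison_coef (x : comparison) (e : A) : R :=
  (e == x.1.2)%:R / x.2.2%:R - (e == x.1.1)%:R / x.2.1%:R.

Definition comparison_const c (x : comparison) : R :=
  c x.1.1 / x.2.1%:R - c x.1.2 / x.2.2%:R.

Lemma comparisonsE c th x : comparisons c th x =
  (\sum_e comparison_coef x e * th e + comparison_const c x <= 0).
Proof.
rewrite ffunE -subr_le0; congr (_ <= 0).
have pick a (k : R) : \sum_e (e == a)%:R / k * th e = th a / k.
  rewrite (bigD1 a) //= eqxx mul1r big1 ?addr0 1?mulrC // => e /negPf ->.
  by rewrite !mul0r.
rewrite /comparison_coef; under eq_bigr do rewrite mulrBl.
by rewrite sumrB !pick /comparison_const; ring.
Qed.

Lemma card_comparison : #|{: comparison}| = (#|A| * #|A| * (N.+1 * N.+1))%N.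
Proof. by rewrite !card_prod !card_ord. Qed.

Section Measurability.
Variables (dT : measure_display) (T : measurableType dT).
Variables (f : T -> A -> {set 'I_N}) (c : T -> A -> R).
Hypothesis mf : forall a i, measurable [set t | i \in f t a].
Hypothesis mc : forall a, measurable_fun setT (fun t => c t a).

Lemma measurable_bigmaxr (I : finType) (F : I -> T -> R) :
  (forall i, measurable_fun setT (F i)) ->
  measurable_fun setT (fun t => \big[Num.max/0]_i F i t).
Proof.
move=> mF; elim: (index_enum I) => [|i r IH].
  by under eq_fun do rewrite big_nil; exact: measurable_cst.
by under eq_fun do rewrite big_cons; exact: measurable_maxr.
Qed.

Lemma measurable_social_cost s : measurable_fun setT (fun t => social_cost (c t) s).
Proof. by apply: measurable_sum => i; exact: measurable_funM. Qed.

Lemma measurable_is_NE_of q s : measurable_fun setT (fun t => is_NE_of (f t) q s).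
Proof.
have mfb i a : measurable_fun setT (fun t => i \in f t a).
  by apply: (measurable_fun_bool true); rewrite setTI preimage_true; exact: mf.
apply: measurable_and; first exact: measurable_forall.
apply: measurable_forall => i; apply: measurable_forall => a.
case: (q _); first by under eq_fun do rewrite implybT; exact: measurable_cst.
by under eq_fun do rewrite implybF; exact: measurable_neg.
Qed.

Lemma measurable_loss_of q : measurable_fun setT (fun t => loss_of (f t) (c t) q).
Proof.
apply: measurable_bigmaxr => s; apply: measurable_fun_ifT => //.
  exact: measurable_is_NE_of.
exact: measurable_social_cost.
Qed.

Lemma measurable_comparison_const x :
  measurable_fun setT (fun t => comparison_const (c t) x).
Proof. by apply: measurable_funB; exact: measurable_funM. Qed.

Lemma measurable_comparisons th q : measurable [set t | comparisons (c t) th = q].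
Proof.
have -> : [set t | comparisons (c t) th = q] =
    [set t | [forall x, comparisons (c t) th x == q x]].
  apply/seteqP; split=> t /=; first by move=> ->; apply/forallP.
  by move=> /forallP h; apply/ffunP => x; exact/eqP.
apply/measurable_set_bool/measurable_forall => x.
have mx : measurable_fun setT (fun t => comparisons (c t) th x).
  under eq_fun do rewrite comparisonsE.
  by apply: measurable_fun_ler => //; apply: measurable_funD => //; exact: measurable_comparison_const.
case: (q x); first by under eq_fun do rewrite eqb_id; exact: mx.
by under eq_fun do rewrite eqbF_neg; exact: measurable_neg.
Qed.

Lemma measurable_realizable_comparisons (H : R) n
    (p : {ffun 'I_n -> {ffun comparison -> bool}}) : 0 <= H ->
  measurable [set u : n.-tuple T |
    realizable (subsidy H) (fun t th => comparisons (c t) th) u p].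
Proof.
move=> H0.
pose be (u : n.-tuple T) (l : 'I_n * comparison) := comparison_const (c (tnth u l.1)) l.2.
have mbe l : measurable_fun setT (be^~ l).
  apply: (@measurableT_comp _ _ _ _ _ _ (fun t => comparison_const (c t) l.2)).
    exact: measurable_comparison_const.
  exact: measurable_tnth.
have := measurable_exists_affine (fun l : 'I_n * comparison => comparison_coef l.2)
  (fun l => p l.1 l.2) mbe H0.
congr measurable; apply/seteqP; split=> u [th [thH h]]; exists th; split=> //.
  by move=> i; apply/ffunP => x; rewrite comparisonsE; exact/esym/(h (i, x)).
by move=> [i x]; rewrite /= -h comparisonsE.
Qed.

Lemma card_realizable_comparisons (H : R) n (u : n.-tuple T)
    (S : {set {ffun 'I_n -> {ffun comparison -> bool}}}) :
  (forall p, p \in S ->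
     realizable (subsidy H) (fun t th => comparisons (c t) th) u p) ->
  (#|S| <= (n * #|{: comparison}|).+1 ^ #|A|)%N.
Proof.
move=> SP.
pose flat (p : {ffun 'I_n -> {ffun comparison -> bool}}) :
  {ffun 'I_n * comparison -> bool} := [ffun l => p l.1 l.2].
have flat_inj : injective flat.
  move=> p1 p2 /ffunP e; apply/ffunP => i; apply/ffunP => x.
  by have := e (i, x); rewrite !ffunE.
rewrite -(card_imset _ flat_inj).
have -> : (n * #|{: comparison}| = #|{: 'I_n * comparison}|)%N.
  by rewrite [RHS]card_prod card_ord.
apply: (@card_affine_patterns R _ _ (fun l => comparison_coef l.2)
  (fun l => comparison_const (c (tnth u l.1)) l.2)).
move=> q /imsetP[p /SP[th [thH h]] ->]; exists th => l.
by rewrite ffunE -h comparisonsE.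
Qed.

End Measurability.
End Game.

(** * Sample complexity *)

(** As [z = a N >= 2], constants are absorbed into powers of [z]: [14 * 4 <= 2^6] and
    [a^3 N^2 <= z^3] give [z^9], while [4^k <= z^(2k)] and [4 <= z^(2a)]. The exponent is
    [2a + (9 + 2k) 2a <= 22 a (k+1)]. *)
Lemma packing_bound_pow (a N k : nat) : (1 < a)%N -> (0 < N)%N ->
  (4 * (14 * a * (a * a * (N.+1 * N.+1)) * 4 ^ k) ^ (2 * a)
    <= ((a * N) ^ (22 * a)) ^ k.+1)%N.
Proof.
move=> a1 N0; set z := (a * N)%N.
have z2 : (2 <= z)%N by apply: leq_trans (leq_mul a1 N0).
have z0 : (0 < z)%N by exact: ltnW.
have pz e : (2 ^ e <= z ^ e)%N by case: e => // e; rewrite leq_exp2r.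
have h1 : (14 * a * (a * a * (N.+1 * N.+1)) <= z ^ 9)%N.
  have z3 : (a * a * a * (N * N) <= z ^ 3)%N.
    have -> : (z ^ 3 = a * a * a * (N * N) * N)%N by rewrite /z !expnS expn0; ring.
    by rewrite leq_pmulr.
  have NN : (N.+1 * N.+1 <= 4 * (N * N))%N by nia.
  apply: (@leq_trans (2 ^ 6 * z ^ 3)); last by rewrite (expnD z 6 3) leq_mul2r pz orbT.
  apply: (@leq_trans (2 ^ 6 * (a * a * a * (N * N)))); last by rewrite leq_mul2l z3 orbT.
  apply: (@leq_trans (14 * a * (a * a * (4 * (N * N))))).
    by rewrite leq_mul // leq_mul.
  have -> : (14 * a * (a * a * (4 * (N * N))) = 56 * (a * a * a * (N * N)))%N by ring.
  by rewrite leq_mul2r orbT.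
have h2 : (4 ^ k <= z ^ (2 * k))%N by rewrite expnM -[4%N]/(2 ^ 2)%N; case: (k) => // k'; rewrite leq_exp2r.
have h3 : (4 <= z ^ (2 * a))%N.
  apply: (@leq_trans (2 ^ (2 * a))); last exact: pz.
  by rewrite -[4%N]/(2 ^ 2)%N leq_exp2l // leq_pmulr // ltnW.
apply: (@leq_trans (z ^ (2 * a) * (z ^ 9 * z ^ (2 * k)) ^ (2 * a))).
  apply: leq_mul => //; rewrite leq_exp2r; first exact: leq_mul.
  by rewrite muln_gt0; exact: ltnW.
rewrite -expnD -!expnM -expnD leq_pexp2l //; nia.
Qed.

Lemma half_le_ln (R : realType) (z : nat) : (1 < z)%N -> 2^-1 <= ln (z%:R : R).
Proof.
move=> z1; have z0 : 0 < z%:R :> R by rewrite ltr0n ltnW.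
rewrite -ler_expR lnK ?posrE //; apply: (@le_trans _ _ 2); last by rewrite ler_nat.
have : expR (2^-1 : R) * expR (- 2^-1) = 1 by rewrite -expRD subrr expR0.
have := expR_ge1Dx (- 2^-1 : R); have := expR_gt0 (2^-1 : R).
by move: (expR _) (expR _) => x y; nra.
Qed.

(** Squaring [z^(22 d)] costs [44 d ln z]. Of the [100], one share of [ln delta^-1] yields [delta],
    and the remaining [56 d ln z], with [d ln z >= 1], covers the factor [1/8]. *)
Lemma exp_bound (R : realType) (z d : nat) (x delta : R) : (1 < z)%N -> (1 < d)%N ->
  0 < delta -> delta <= 1 ->
  100 * (d%:R * ln (z%:R : R) + ln delta^-1) <= x ->
  (z ^ (22 * d))%:R ^+ 2 * expR (- x) <= delta / 8.
Proof.
move=> z1 d1 delta0 delta1 hx; set L := ln (z%:R : R) in hx *.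
have z0 : 0 < z%:R :> R by rewrite ltr0n ltnW.
have L2 : 2^-1 <= L by exact: half_le_ln.
have dL : 1 <= d%:R * L by have : 2 <= d%:R :> R by [rewrite ler_nat]; nra.
have -> : (z ^ (22 * d))%:R ^+ 2 = expR (44 * (d%:R * L)).
  rewrite natrX -exprM -[in LHS](lnK (x := z%:R)) ?posrE // -expRM_natl -/L.
  by congr expR; rewrite !natrM; ring.
have ld : 0 <= ln delta^-1 by apply: ln_ge0; rewrite invf_ge1.
have lnd : ln delta = - ln delta^-1 by rewrite lnV ?posrE // opprK.
rewrite -expRD; apply: (@le_trans _ _ (expR (ln delta) * expR (- (56 * (d%:R * L))))).
  by rewrite -expRD ler_expR lnd; lra.
rewrite lnK ?posrE // ler_pM2l // expRN lef_pV2 ?posrE ?expR_gt0 //.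
by apply: le_trans (expR_ge1Dx _); lra.
Qed.

Theorem theorem12 (R : realType) :
  exists C : R, 0 < C /\
  forall (N : nat) (A : finType) (H eps delta : R),
    0 <= H -> 0 < eps -> 0 < delta ->
  forall (dT : measure_display) (T : measurableType dT) (D : probability T R)
    (f : T -> A -> {set 'I_N}) (c : T -> A -> R),
    (forall a i, measurable [set t | i \in f t a]) ->
    (forall a, measurable_fun setT (fun t => c t a)) ->
    (forall t a, 0 <= c t a <= H) ->
  forall (dO : measure_display) (Omega : measurableType dO)
    (P : probability Omega R) (m : nat) (X : 'I_m -> Omega -> T),
    (forall j, measurable_fun setT (X j)) ->
    (forall j B, measurable B -> P (X j @^-1` B) = D B) ->
    mutually_independent P X ->
    C * (#|A|%:R ^+ 2 * H ^+ 2 / eps ^+ 2) *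
      (#|A|%:R * ln (#|A|%:R * N%:R) + ln delta^-1) <= m%:R ->
    let expected_loss := fun cS : A -> R =>
      (\int[D]_t (loss_prior (f t) (c t) cS)%:E)%E in
    let empirical_loss := fun (w : Omega) (cS : A -> R) =>
      m%:R^-1 * \sum_(j < m) loss_prior (f (X j w)) (c (X j w)) cS in
    exists E : set Omega, measurable E /\ ((1 - delta)%:E <= P E)%E /\
      forall w, E w ->
      forall cS_hat : A -> R, subsidy H cS_hat ->
        (forall cS : A -> R, subsidy H cS ->
           empirical_loss w cS_hat <= empirical_loss w cS) ->
        (expected_loss cS_hat <=
           ereal_inf [set expected_loss cS | cS in subsidy H] + eps%:E)%E.
Proof.
(* [16] comes from [eta = eps / 4], [72 * 80] from the chaining exponent and [100] from
   [exp_bound]. *)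
exists (16 * 72 * 80 * 100); split; first by rewrite !mulr_gt0.
move=> N A H eps delta H0 eps0 delta0 dT T D f c mf mc cH dO Omega P m X mX lX iX hm.
move=> expected_loss empirical_loss.
have [delta1|delta1] := leP 1 delta.
  exists set0; split=> //; split=> //.
  by rewrite measure0 lee_fin subr_le0.
(* In these cases all admissible subsidies have the same loss, so the sure event works for any
   sample, even an empty one. *)
have [deg|] := boolP ((#|A| <= 1)%N || (N == 0%N) || (H == 0)).
  exists setT; split=> //; split.
    by rewrite probability_setT lee_fin lerBlDr lerDl ltW.
  move=> w _ hat hatH _; rewrite -leeBlDr //; apply: le_ereal_inf_tmp => _ [cS cSH <-].
  have -> : expected_loss cS = expected_loss hat.
    apply: eq_integral => t _; congr (_%:E).
    case/orP: deg => [deg|/eqP H1]; first exact: loss_prior_constant.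
    congr loss_prior; apply/funext => a; have := cSH a; have := hatH a.
    by rewrite H1 => /le_anti <- /le_anti <-.
  by rewrite leeBlDr // leeDl // lee_fin ltW.
rewrite !negb_or -ltnNge -lt0n => /andP[/andP[A1 N0] Hn0].
have Hgt : 0 < H by rewrite lt0r Hn0.
pose B := #|A|%:R * H.
have A0 : 0 < #|A|%:R :> R by rewrite ltr0n ltnW.
have B0 : 0 < B by rewrite mulr_gt0.
pose z := (#|A| * N)%N.
have z1 : (1 < z)%N by apply: leq_trans (leq_mul A1 N0).
pose Lam := #|A|%:R * ln (z%:R : R) + ln delta^-1.
have Lam1 : 1 <= Lam.
  have := half_le_ln R z1; have : 2 <= #|A|%:R :> R by rewrite ler_nat.
  have : 0 <= ln delta^-1 by apply: ln_ge0; rewrite invf_ge1 // ltW.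
  by rewrite /Lam; move: (ln _) (ln _) => u v; nra.
(* Deviations are then at most [2 eta = eps / 2], and comparing the empirical minimizer with a
   competitor uses this twice. *)
pose eta := eps / 4.
have eta0 : 0 < eta by rewrite divr_gt0.
have hm' : 72 * 80 * 100 * (B ^+ 2 * Lam) <= m%:R * eta ^+ 2.
  have e1 : eps != 0 by rewrite gt_eqF.
  have -> : 72 * 80 * 100 * (B ^+ 2 * Lam) =
    16 * 72 * 80 * 100 * (#|A|%:R ^+ 2 * H ^+ 2 / eps ^+ 2) * Lam * eta ^+ 2.
    by rewrite /B /eta; field.
  by apply: ler_wpM2r; [rewrite sqr_ge0|rewrite /Lam /z natrM].
have B20 : 0 < B ^+ 2 by rewrite exprn_gt0.
have m0 : (0 < m)%N.
  rewrite -(ltr0n R) -(pmulr_lgt0 _ (_ : 0 < eta ^+ 2)) ?exprn_gt0 //.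
  by apply: lt_le_trans hm'; rewrite !mulr_gt0 // (lt_le_trans ltr01).
have mR0 : 0 < m%:R :> R by rewrite ltr0n.
have iidX : iid_sample D P X by split.
have Q0 : (0 < #|{: comparison N A}|)%N.
  by rewrite card_comparison !muln_gt0 /= (ltnW A1).
have Y0 : (0 < z ^ (22 * #|A|))%N by rewrite expn_gt0 (ltnW z1).
have packY k : (4 * (14 * #|A| * #|{: comparison N A}| * 4 ^ k) ^ (2 * #|A|)
    <= (z ^ (22 * #|A|)) ^ k.+1)%N.
  by rewrite card_comparison; exact: packing_bound_pow.
have expY : (z ^ (22 * #|A|))%:R ^+ 2 *
    expR (- (m%:R * eta ^+ 2 / (72 * 80 * B ^+ 2))) <= delta / 8.
  apply: exp_bound => //; first exact: ltW.
  rewrite ler_pdivlMr ?mulr_gt0 //; apply: le_trans hm'.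
  by rewrite -/Lam le_eqVlt; apply/orP; left; apply/eqP; ring.
have mB : 2 * B ^+ 2 <= m%:R * eta ^+ 2.
  apply: le_trans hm'; rewrite [leRHS](_ : _ = 72 * 80 * 100 * Lam * B ^+ 2); last by ring.
  rewrite ler_pM2r //.
  by apply: (@le_trans _ _ (72 * Lam)); lra.
have [E [mE PE devE]] := uniform_deviation B0 Q0 (ltnW A1)
  (fun t q => loss_of_bounds (f t) q (cH t)) (measurable_loss_of mf mc)
  (measurable_comparisons mc) (fun n p => measurable_realizable_comparisons mc p H0)
  (fun n u S => @card_realizable_comparisons R N A dT T c H n u S)
  m0 eta0 (ltW delta1) Y0 packY expY iidX mB.
exists E; split=> //; split=> // w Ew hat hatH hat_min.
pose mu cS := fine (expected_loss cS).
have expE cS : expected_loss cS = (mu cS)%:E.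
  rewrite /mu fineK //; apply: integrable_fin_num => //.
  apply: (@bounded_integrable _ _ _ D (fun t => loss_prior (f t) (c t) cS) B).
    under eq_fun do rewrite loss_prior_comparisons.
    exact: (measurable_loss (measurable_loss_of mf mc) (measurable_comparisons mc)).
  move=> t; rewrite loss_prior_comparisons.
  by have /andP[l0 lB] := loss_of_bounds (f t) (comparisons N (c t) cS) (cH t); rewrite ger0_norm.
have dev cS : subsidy H cS -> `|empirical_loss w cS - mu cS| <= eps / 2.
  move=> cSH; have := devE w Ew cS cSH.
  have -> : \sum_(j < m) loss_of (f (X j w)) (c (X j w)) (comparisons N (c (X j w)) cS) =
      m%:R * empirical_loss w cS.
    rewrite /empirical_loss mulrA mulfV ?gt_eqF // mul1r.
    by apply: eq_bigr => j _; rewrite loss_prior_comparisons.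
  have -> : (\int[D]_t (loss_of (f t) (c t) (comparisons N (c t) cS))%:E)%E = expected_loss cS.
    by apply: eq_integral => t _; rewrite loss_prior_comparisons.
  rewrite -/(mu cS) -mulrBr normrM (ger0_norm (ltW mR0)).
  have -> : 2 * (m%:R * eta) = m%:R * (eps / 2) by rewrite /eta; field.
  by rewrite ler_pM2l.
rewrite -leeBlDr //; apply: le_ereal_inf_tmp => _ [cS cSH <-].
rewrite !expE -EFinB lee_fin.
have := dev _ cSH; have := dev _ hatH; have := hat_min _ cSH.
rewrite !ler_norml => ? /andP[? ?] /andP[? ?].
by lra.
Qed.
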